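(* Let $\Sigma=\{0,1\}^{\mathbb{N}_0}$ with the shift $\sigma$, and let $\overline{0}$ and $\overline{1}$ be the constant sequences in $\Sigma$ equal to $0$ and $1$, respectively. There is a Lipschitz continuous potential $\varphi\colon\Sigma\to\mathbb{R}$ such that the Gibbs measures $(\rho_{\beta\cdot\varphi})_{\beta>0}$ accumulate (weak* ) at the same time on $\delta_{\overline{0}}$ and on $\delta_{\overline{1}}$ as $\beta\to+\infty$, so that $\lim_{\beta\to+\infty}\rho_{\beta\cdot\varphi}$ does not exist, whereas $\lim_{n\to+\infty}\mathcal{M}_n$ exists and equals $\tfrac12(\delta_{\overline{0}}+\delta_{\overline{1}})$. In particular, the existence of $\lim_{\beta\to+\infty}\rho_{\beta\cdot\varphi}$ is not equivalent to the existence of $\lim_{n\to+\infty}\mathcal{M}_n$ for general Lipschitz continuous $\varphi$.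
   Context: $\Sigma=\{0,1\}^{\mathbb{N}_0}$ has the distance $\mathrm{dist}((\theta_n),(\theta'_n))=2^{-\min\{n:\theta_n\ne\theta'_n\}}$ for distinct elements. For Lipschitz continuous $\varphi\colon\Sigma\to\mathbb{R}$, the Gibbs measure $\rho_\varphi$ is the unique $\sigma$-invariant Borel probability measure attaining the supremum of $h_\nu+\int\varphi\,d\nu$ over $\sigma$-invariant Borel probability measures $\nu$, with $h_\nu$ the measure-theoretic entropy. For Lipschitz continuous $\varphi$, $\mathcal{M}_\sigma(\varphi)$ is the set of $\sigma$-invariant Borel probability measures $\rho$ on $\Sigma$ that maximize $\int\varphi\,d\rho$ among $\sigma$-invariant probability measures. For $n\ge1$, $\pi_n\colon\Sigma\to\{0,1\}^n$ is the projection to the first $n$ coordinates, and $\mathcal{M}_n^*=\{(\pi_n)_*\mu:\mu\in\mathcal{M}_\sigma(\varphi)\}$. The (Shannon) entropy function on $\mathcal{M}_n^*$ is strictly concave, so it attains its maximum at a unique point $\mu_n^*$; put $\mathcal{M}_n=\{\mu\in\mathcal{M}_\sigma(\varphi):(\pi_n)_*\mu=\mu_n^*\}$. One says $\lim_{n\to+\infty}\mathcal{M}_n$ exists and equals $\mu$ if for every choice of $\mu_n\in\mathcal{M}_n$, $n\ge1$, the sequence $(\mu_n)$ converges to $\mu$ in the weak* topology. *)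

(* Defs.v *)
From HB Require Import structures.
From mathcomp Require Import all_boot all_order all_algebra.
From mathcomp Require Import all_classical all_reals all_analysis.

Set Implicit Arguments.
Unset Strict Implicit.
Unset Printing Implicit Defensive.

Import Order.TTheory GRing.Theory Num.Theory.
Import numFieldNormedType.Exports.

Local Open Scope classical_set_scope.
Local Open Scope ring_scope.

(* The library's Cantor space (product topology) with its Borel sigma-algebra. *)
Definition Sigma : Type := g_sigma_algebraType (@open cantor_space).

HB.instance Definition _ :=
  Measurable.on Sigma.
HB.instance Definition _ := Topological.copy Sigma cantor_space.

Definition shift (x : Sigma) : Sigma := fun n => x n.+1.

Definition zero_bar : Sigma := fun _ => false.
Definition one_bar : Sigma := fun _ => true.

Section Dynamics.
Variable R : realType.

Definition sdist (x y : Sigma) : R :=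
  match pselect (exists n, x n != y n) with
  | left ex => 2 ^- ex_minn ex
  | right _ => 0
  end.

Definition lipschitz_potential (phi : Sigma -> R) : Prop :=
  exists K : R, forall x y, `|phi x - phi y| <= K * sdist x y.

Local Notation prob := (probability Sigma R).

Definition invariant : set prob :=
  [set mu | forall A : set Sigma, measurable A -> mu (shift @^-1` A) = mu A].

(* Natural logarithm; [ln 0 = 0] gives the convention 0 log 0 = 0. *)
Definition shannon (I : finType) (p : I -> R) : R :=
  - \sum_(i : I) p i * ln (p i).

(* A finite measurable partition is given by its labelling xi : Sigma -> 'I_k;
   the atoms of its n-th dynamical refinement are indexed by the words w. *)
Definition refined_prob (mu : prob) k (xi : Sigma -> 'I_k) n
    (w : {ffun 'I_n -> 'I_k}) : R :=
  fine (mu [set x | forall i : 'I_n, xi (iter i shift x) = w i]).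

Definition entropy_partition (mu : prob) k (xi : Sigma -> 'I_k) : R :=
  limn (fun n => shannon (refined_prob mu xi (n := n)) / n%:R).

(* Kolmogorov-Sinai entropy. *)
Definition entropy (mu : prob) : \bar R :=
  ereal_sup [set h | exists k (xi : Sigma -> 'I_k),
    (forall i, measurable (xi @^-1` [set i])) /\
    h = (entropy_partition mu xi)%:E].

Definition free_energy (phi : Sigma -> R) (mu : prob) : \bar R :=
  (entropy mu + \int[mu]_x (phi x)%:E)%E.

Definition equilibrium (phi : Sigma -> R) : set prob :=
  [set mu | invariant mu /\
    free_energy phi mu = ereal_sup [set free_energy phi nu | nu in invariant]].

(* For Lipschitz phi the equilibrium state is unique as a Borel measure, and
   [get] denotes it. *)
Definition gibbs (phi : Sigma -> R) : prob := get (equilibrium phi).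

Definition maximizing (phi : Sigma -> R) : set prob :=
  [set mu | invariant mu /\ forall nu, invariant nu ->
    (\int[nu]_x (phi x)%:E <= \int[mu]_x (phi x)%:E)%E].

Definition proj n (x : Sigma) : n.-tuple bool := [tuple x i | i < n].

(* Measures on the finite set {0,1}^n are handled as set functions. *)
Definition shannon_measure n (m : set (n.-tuple bool) -> \bar R) : R :=
  shannon (fun w : n.-tuple bool => fine (m [set w])).

Definition marginals (phi : Sigma -> R) n :
    set (set (n.-tuple bool) -> \bar R) :=
  [set pushforward mu (@proj n) | mu in maximizing phi].
Arguments marginals phi n : clear implicits.

(* The (unique, by strict concavity) entropy maximizer among the marginals. *)
Definition mu_star (phi : Sigma -> R) n : set (n.-tuple bool) -> \bar R :=
  get [set m | marginals phi n m /\
    forall m', marginals phi n m' -> shannon_measure m' <= shannon_measure m].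
Arguments mu_star phi n : clear implicits.

Definition max_ent (phi : Sigma -> R) n : set prob :=
  [set mu | maximizing phi mu /\ pushforward mu (@proj n) = mu_star phi n].

(* Coarsest topology making every evaluation mu |-> \int f dmu, f continuous,
   continuous. *)
Definition wstar_eval (mu : prob) :
    prod_topology (fun _ : continuousType Sigma R => R) :=
  fun f => Rintegral mu setT f.

Definition wstar : Type := initial_topology wstar_eval.

HB.instance Definition _ := Topological.on wstar.

Definition max_ent_lim (phi : Sigma -> R) (mu : wstar) : Prop :=
  forall u : nat -> wstar, (forall n, (0 < n)%N -> max_ent phi n (u n)) ->
    u n @[n --> \oo] --> mu.

Definition gibbs_family (phi : Sigma -> R) (beta : R) : wstar :=
  gibbs (fun x => beta * phi x).

Definition midpoint_measure : set Sigma -> \bar R :=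
  mscale (2^-1 : R)%:nng (measure_add (dirac zero_bar) (dirac one_bar)).

HB.instance Definition _ := Measure.on midpoint_measure.

Let midpoint_setT : midpoint_measure setT = 1%E.
Proof.
rewrite /midpoint_measure /mscale.
rewrite [X in (_ * X)%E](_ : _ = dirac zero_bar setT + dirac one_bar setT)%E;
  last exact: measure_addE.
by rewrite !diracT -EFinD -EFinM /= mulrDr mulr1 {3}[1](splitr 1) div1r.
Qed.

HB.instance Definition _ :=
  Measure_isProbability.Build _ _ _ midpoint_measure midpoint_setT.

Definition delta (x : Sigma) : wstar := (dirac x : prob).

Definition midpoint : wstar := (midpoint_measure : prob).

End Dynamics.

(* The topology of Sigma is the one of [sdist], and [wstar] is the usual weak*
   topology. *)
Lemma prod_cvgP (I : eqType) (T : I -> topologicalType) (F : set_system (prod_topology T)) (x : prod_topology T) : Filter F ->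
  F --> x <-> forall i, (y i) @[y --> F] --> x i.
Proof.
move=> FF; split.
  move=> Fx i A nA; have H := @proj_continuous I T i x A nA; exact: (Fx _ H).
move=> h; apply/cvg_sup => i A [_ [[B oB <-] Bx sub]].
by apply: (filterS sub); apply: (h i B); apply: open_nbhs_nbhs.
Qed.

Lemma wstar_cvgP (R : realType) (F : set_system (wstar R)) (mu : wstar R) : Filter F ->
  F --> mu <-> forall f : continuousType Sigma R,
   Rintegral nu setT f @[nu --> F] --> Rintegral mu setT f.
Proof.
move=> FF; have FE : Filter (wstar_eval (R:=R) @ F) by apply: fmap_filter.
have P := @prod_cvgP _ (fun _ : continuousType Sigma R => R) _ (wstar_eval mu) FE.
split.
  move=> Fmu; apply P => A nA. 
  have := @initial_continuous _ _ (@wstar_eval R) mu A nA.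
  exact: Fmu.
move=> /P {}P A; rewrite /= => -[_ [[B oB <-] Bmu sub]].
apply: (filterS sub).
by apply: (P B); apply: open_nbhs_nbhs.
Qed.

Lemma sdist_nbhs (R : realType) (x : Sigma) (A : set Sigma) :
  nbhs x A <-> exists2 e : R, 0 < e & [set y | sdist R x y < e] `<=` A.
Proof.
have cyl n : nbhs x [set y : Sigma | forall i, (i < n)%N -> y i = x i].
  elim: n => [|n IH]; first by apply: filterS filterT => y _ i.
  have pn : nbhs x [set y : Sigma | y n = x n].
    have := @proj_continuous nat (fun=> bool) n x [set x n].
    by apply; exact: discrete_set1.
  apply: filterS (filterI IH pn) => y [/= h1 h2] i; rewrite ltnS leq_eqVlt.
  by case/orP => [/eqP -> //|]; exact: h1.
split; last first.
  case=> e e0 sA; apply: filterS sA _.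
  have [n hn] : exists n, 2 ^- n < e.
    have := @cvg_geometric R 1 (2^-1) _.
    rewrite ger0_norm ?invr_ge0// invf_lt1 ?ltr1n// => /(_ isT).
    move=> /cvgrPdist_lt /(_ e e0) [n _ /(_ n (leqnn n))] /=.
    rewrite sub0r normrN mul1r ger0_norm ?exprn_ge0 ?invr_ge0// exprVn => h.
    by exists n.
  apply: filterS (cyl n) => y hy /=; rewrite /sdist; case: pselect => // ex.
  case: ex_minnP => m hm _; apply: le_lt_trans hn.
  rewrite lef_pV2 ?posrE ?exprn_gt0// ler_eXn2l ?ltr1n// leqNgt.
  by apply/negP => /hy E; rewrite E eqxx in hm.
move=> nA; apply: contrapT => H.
have /choice[y yP] n : exists y : Sigma, (forall i, (i < n)%N -> y i = x i) /\ ~ A y.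
  apply: contrapT => h; apply: H; exists (2 ^- n); first by rewrite invr_gt0 exprn_gt0.
  move=> z /= hz; apply: contrapT => nz; apply: h; exists z; split=> // i il.
  move: hz; rewrite /sdist; case: pselect => [ex|nex].
    case: ex_minnP => m hm minm; rewrite ltf_pV2 ?posrE ?exprn_gt0//.
    rewrite ltr_eXn2l ?ltr1n// => nm; apply/esym/eqP; apply/negPn/negP => hi.
    by have := leq_ltn_trans (minm _ hi) il; rewrite ltnNge (ltnW nm).
  by move=> _; apply/esym/eqP; apply/negPn/negP => hi; apply: nex; exists i.
have yx : y n @[n --> \oo] --> (x : Sigma).
  apply/(@prod_cvgP nat (fun=> bool) (y @ \oo)) => i B /nbhs_singleton Bx.
  by exists i.+1 => // n /= hn; rewrite /= (yP n).1.
have [n _ /(_ n (leqnn n))] := yx A nA.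
exact: (yP n).2.
Qed.

(* Main.v *)
(* Price a sequence only when its first two letters differ, by an amount [c_s(n)] depending on
   the new letter [s] and on the length [n] of the run that begins there; the maximizing measures
   are then the mixtures of the two Dirac masses at the fixed points, and entropy selects the
   midpoint among their marginals.
   At inverse temperature [beta], words are weighted by products, over their runs, of
   [exp (- beta c_s(n) - P n)], and the pressure [P] is the value making the product of the two
   total run weights equal to 1.  The associated stationary renewal process is an explicit
   equilibrium state; conversely the same weights, through Gibbs' inequality, bound the free energy
   of every invariant measure.  Applied with different rates for the two letters, this bound
   controls the mass which an arbitrary equilibrium state gives to each letter.
   If runs of [s] shorter than [N] are priced out and runs of the other letter are free beyond
   length [M], then [P] is about [2 log(1/P) / (N + M)], so [P N] is large, and for [M << N] the
   equilibrium states concentrate on the fixed point of [s].  Taking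
   [c_s(n) = 2^-min {i! : i! >= n, i = s mod 2}] makes the two letters alternate at
   [beta = k! 2^(k!)]. *)
From Pilot Require Import Defs.
From HB Require Import structures.
From mathcomp Require Import all_boot all_order all_algebra.
From mathcomp Require Import all_classical all_reals all_analysis.
From mathcomp Require Import measurable_realfun ring lra.
Import Order.TTheory GRing.Theory Num.Theory.
Import numFieldNormedType.Exports.
Local Open Scope classical_set_scope.
Local Open Scope ring_scope.
Set Implicit Arguments.
Unset Strict Implicit.
Unset Printing Implicit Defensive.
(* MathComp-Analysis also has a [shift]. *)
Import Pilot.Defs.

(** * Cylinders and the Borel sets *)

Section Cylinders.

(** [gibbs] is a value of [get]: it is informative only once an equilibrium state is known to exist,
    and then every estimate must hold for whichever one is picked. Hence the need for an attained
    upper bound on the free energy, for an entropy that is a supremum over all finite partitions.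
    The masses of the letters are found by deforming the rates. If rates [a s] replace the common
    rate [P] while the product of the two run totals stays at most 1, then [P] is at most the
    average of [a s] over the letter masses. The totals react very differently: that of the letter
    [b] with long runs behaves like exp (- N a_b) / a_b, that of the other letter only like the
    inverse of its rate. So the rate of the other letter can be almost halved for a factor 2, which
    a slight increase of [a b] repays because P N is large. With (1 + eta) P and (1/2 + eta) P, the
    inequality leaves a mass of at most 2 eta to the other letter. Heuristically, runs of [b] have
    mean length about N + 1/P, against at most about M + 1/P for the others. *)

Definition cyl (w : seq bool) : set Sigma := [set x | mkseq x (size w) = w].

Lemma cylE w x : cyl w x = (mkseq x (size w) = w). Proof. by []. Qed.

Lemma cyl_mkseq x y n : cyl (mkseq x n) y = (mkseq y n = mkseq x n).
Proof. by rewrite cylE size_mkseq. Qed.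

Lemma mkseq_eqP (x y : Sigma) n :
  mkseq x n = mkseq y n <-> forall i, (i < n)%N -> x i = y i.
Proof.
split=> [E i il|h]; last by apply/eq_in_map => i; rewrite mem_iota => /h.
by have := congr1 (nth false ^~ i) E; rewrite !nth_mkseq.
Qed.

Lemma mkseq_shift (x : Sigma) n : mkseq x n.+1 = x 0%N :: mkseq (shift x) n.
Proof. by rewrite /mkseq /= (iotaDl 1 0 n) -map_comp. Qed.

Lemma mkseq_shift_inj (x y : Sigma) n : mkseq x n.+1 = mkseq y n.+1 ->
  x 0%N = y 0%N /\ mkseq (shift x) n = mkseq (shift y) n.
Proof. by rewrite !mkseq_eqP => h; split=> [|i il]; exact: h. Qed.

Lemma iter_shiftE (x : Sigma) i j : iter i shift x j = x (i + j)%N.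
Proof. by elim: i j => //= i IH j; rewrite /shift IH addnS. Qed.

Lemma nbhs_cyl (x : Sigma) n : nbhs x (cyl (mkseq x n)).
Proof.
elim: n => [|n IH]; first by apply: filterS filterT => y _.
have xn : nbhs x [set y : Sigma | y n = x n].
  by apply: (@proj_continuous nat (fun=> bool) n x [set x n]); exact: discrete_set1.
apply: filterS (filterI IH xn) => y []; rewrite !cyl_mkseq !mkseq_eqP /= => h1 h2 i.
by rewrite ltnS leq_eqVlt => /orP[/eqP->|/h1].
Qed.

(** Otherwise points outside [A] agreeing with [x] on longer and longer prefixes would converge to
    [x] coordinatewise. *)
Lemma nbhs_cylP (x : Sigma) (A : set Sigma) :
  nbhs x A <-> exists n, cyl (mkseq x n) `<=` A.
Proof.
split=> [nA|[n sA]]; last exact: filterS sA (nbhs_cyl x n).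
apply: contrapT => /forallNP H.
have /choice[y yP] n : exists y : Sigma, cyl (mkseq x n) y /\ ~ A y.
  apply: contrapT => /forallNP h; apply: (H n) => z xz; apply: contrapT => nAz.
  by apply: (h z).
have yx : y n @[n --> \oo] --> (x : Sigma).
  apply/(@prod_cvgP nat (fun=> bool) (y @ \oo)) => i B /nbhs_singleton Bx.
  exists i.+1 => // n /= hn; have [] := yP n; rewrite cyl_mkseq mkseq_eqP => -> //.
have [n _ /(_ n (leqnn n))] := yx A nA.
exact: (yP n).2.
Qed.

Lemma open_cyl w : open (cyl w).
Proof.
rewrite openE => x xw; apply/nbhs_cylP; exists (size w) => y.
by rewrite cyl_mkseq => E; exact: etrans E xw.
Qed.

Lemma measurable_open (A : set Sigma) : open A -> measurable A.
Proof. exact: sub_sigma_algebra. Qed.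

Lemma measurable_cyl w : measurable (cyl w).
Proof. by apply: measurable_open; exact: open_cyl. Qed.

Lemma open_bigcup_cyl (A : set Sigma) : open A ->
  A = \bigcup_(w in [set w | cyl w `<=` A]) cyl w.
Proof.
move=> oA; apply/seteqP; split=> [x Ax|x [w /= sA /sA//]].
have /nbhs_cylP[n sA] : nbhs x A by apply: open_nbhs_nbhs.
by exists (mkseq x n) => //; rewrite cyl_mkseq.
Qed.

(** The empty set is added to make the family stable under intersection, as uniqueness of measures
    on a generating family requires. *)
Definition cylinders : set (set Sigma) := set0 |` range cyl.

Lemma measurable_cylE : @measurable _ Sigma = <<s cylinders >>.
Proof.
rewrite /measurable /=; apply/seteqP; split.
  apply: smallest_sub; first exact: smallest_sigma_algebra.
  move=> A oA; rewrite (open_bigcup_cyl oA).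
  (* Words are enumerated through [unpickle], which makes the union of cylinders a countable one. *)
  pose F (o : option (seq bool)) :=
    if o is Some w then if `[< cyl w `<=` A >] then cyl w else set0 else set0.
  have -> : \bigcup_(w in [set w | cyl w `<=` A]) cyl w = \bigcup_n F (unpickle n).
    apply/seteqP; split=> [x [w wA xw]|x [n _]].
      by exists (pickle w) => //; rewrite pickleK /F; case: asboolP.
    by rewrite /F; case: unpickle => // w; case: asboolP => // wA xw; exists w.
  apply: sigma_algebra_bigcup => n; rewrite /F; case: unpickle => [w|]; last exact: sigma_algebra0.
  case: ifP => _; last exact: sigma_algebra0.
  by apply: sub_sigma_algebra; right; exists w.
apply: smallest_sub; first exact: smallest_sigma_algebra.
move=> _ [->|[w _ <-]]; first exact: sigma_algebra0.
by apply: sub_sigma_algebra; exact: open_cyl.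
Qed.

Lemma cyl_cap w w' : (size w <= size w')%N -> cyl w `&` cyl w' =
  if take (size w) w' == w then cyl w' else set0.
Proof.
move=> le; case: eqP => E; apply/seteqP; split=> x //=.
- by case.
- move=> xw'; split=> //; rewrite /cyl /= -{2}E -[X in take _ X]xw'.
  by rewrite /mkseq -map_take take_iota (minn_idPl le).
- case=> xw xw'; apply: E; rewrite -[X in take _ X]xw' -[RHS]xw.
  by rewrite /mkseq -map_take take_iota (minn_idPl le).
Qed.

Lemma setI_closed_cylinders : setI_closed cylinders.
Proof.
move=> A B [->|[w _ <-]]; first by rewrite set0I; left.
move=> [->|[w' _ <-]]; first by rewrite setI0; left.
wlog le : w w' / (size w <= size w')%N.
  by move=> H; case: (leqP (size w) (size w')) => [/H//|/ltnW/H]; rewrite setIC.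
by rewrite cyl_cap//; case: ifP => _; [right; exists w'|left].
Qed.

Lemma cyl_nil : cyl [::] = setT. Proof. by apply/seteqP; split. Qed.

Lemma eq_probability_cyl (R : realType) (mu nu : probability Sigma R) :
  (forall w, mu (cyl w) = nu (cyl w)) ->
  forall A, measurable A -> mu A = nu A.
Proof.
move=> E A mA.
apply: (@measure_unique _ R Sigma cylinders (fun=> setT)) => //.
- exact: measurable_cylE.
- exact: setI_closed_cylinders.
- by move=> _; right; exists [::] => //; exact: cyl_nil.
- by apply/seteqP; split=> // x _; exists 0%N.
- by move=> B [->|[w _ <-]]; [rewrite !measure0|exact: E].
- by move=> _; rewrite (le_lt_trans (probability_le1 _ _)) ?ltry.
Qed.

Lemma measurable_fun_cyl d (T : measurableType d) (f : T -> Sigma) :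
  (forall w, measurable (f @^-1` cyl w)) -> measurable_fun setT f.
Proof.
move=> h; apply: (measurability cylinders).
  by rewrite -measurable_cylE.
move=> _ [_ [->|[w _ <-]] <-]; rewrite setTI ?preimage_set0//.
Qed.

Lemma preimage_shift_cyl w :
  shift @^-1` cyl w = cyl (false :: w) `|` cyl (true :: w).
Proof.
apply/seteqP; split=> x; rewrite /cyl /= !mkseq_shift; last by case=> -[].
by move=> /= ->; case: (x 0%N); [right|left].
Qed.

Lemma measurable_shift : measurable_fun setT (shift : Sigma -> Sigma).
Proof.
apply: measurable_fun_cyl => w; rewrite preimage_shift_cyl.
by apply: measurableU; exact: measurable_cyl.
Qed.

Lemma measurable_fun_continuous (R : realType) (f : Sigma -> R) :
  continuous f -> measurable_fun setT f.
Proof.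
move=> /continuousP cf.
apply: (measurability _ (measurable_realfun.RGenOpens.measurableE R)).
move=> _ [_ [a [b ->]] <-]; rewrite setTI; apply: measurable_open.
by apply: cf; exact: interval_open.
Qed.

Lemma measurable_mkseq n (P : pred (seq bool)) :
  measurable [set x : Sigma | P (mkseq x n)].
Proof.
have -> : [set x : Sigma | P (mkseq x n)] =
   \bigcup_(w in [set w : n.-tuple bool | P w]) cyl w.
  apply/seteqP; split=> [x Px|x [w /= Pw]]; last first.
    by rewrite /cyl /= size_tuple => ->.
  exists (Tuple (introT eqP (size_mkseq x n))) => //=; by rewrite cyl_mkseq.
apply: fin_bigcup_measurable => [|w _]; first exact: finite_finset.
exact: measurable_cyl.
Qed.


End Cylinders.

(** * Approximation of Borel sets by cylindrical sets *)

Section Approximation.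
Variable R : realType.

Definition cylindrical n (P : pred (seq bool)) : set Sigma :=
  [set x | P (mkseq x n)].

Definition approximable (mu : probability Sigma R) (A : set Sigma) :=
  measurable A /\ forall e : R, 0 < e -> exists n P,
    (mu (A `+` cylindrical n P) <= e%:E)%E.

Lemma cylindrical_le n m P : (n <= m)%N ->
  cylindrical n P = cylindrical m (fun w => P (take n w)).
Proof.
move=> nm; apply/seteqP; split=> x;
  by rewrite /cylindrical /= /mkseq -map_take take_iota (minn_idPl nm).
Qed.

Lemma measurable_setY (A B : set Sigma) : measurable A -> measurable B ->
  measurable (A `+` B).
Proof. by move=> mA mB; apply: measurableU; exact: measurableD. Qed.

Lemma approximableU mu A B : approximable mu A -> approximable mu B ->
  approximable mu (A `|` B).
Proof.
move=> [mA hA] [mB hB]; split=> [|e e0]; first exact: measurableU.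
have e20 : 0 < e / 2 by rewrite divr_gt0.
have [n [P hP]] := hA _ e20; have [m [Q hQ]] := hB _ e20.
exists (maxn n m), (fun w => P (take n w) || Q (take m w)).
move: hP hQ; rewrite (cylindrical_le P (leq_maxl n m)).
rewrite (cylindrical_le Q (leq_maxr n m)).
set P' := fun w => P _; set Q' := fun w => Q _ => hP hQ.
rewrite [e]splitr EFinD; apply: le_trans (leeD hP hQ).
apply: le_trans (measureU2 _ _ _); rewrite ?inE.
- apply: le_measure; rewrite ?inE.
  + by apply: measurable_setY; [exact: measurableU|exact: measurable_mkseq].
  + by apply: measurableU; apply: measurable_setY => //; exact: measurable_mkseq.
  + rewrite /cylindrical /setY /setD => x /=.
    rewrite -/(P' _) -/(Q' _) => -[[ABx /negP]|[/orP PQ nAB]].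
      rewrite negb_or => /andP[/negP nP /negP nQ].
      by case: ABx => h; [left|right]; left.
    case: PQ => h; [left|right]; right; split=> // h'; apply: nAB.
      by left.
    by right.
- by apply: measurable_setY => //; exact: measurable_mkseq.
- by apply: measurable_setY => //; exact: measurable_mkseq.
Qed.

Lemma approximable_cyl mu w : approximable mu (cyl w).
Proof.
split=> [|e e0]; first exact: measurable_cyl.
exists (size w), (pred1 w).
have -> : cylindrical (size w) (pred1 w) = cyl w.
  by apply/seteqP; split=> x /eqP.
by rewrite setYK measure0 lee_fin ltW.
Qed.

Lemma approximable_set0 mu : approximable mu set0.
Proof.
split=> // e e0; exists 0%N, pred0.
have -> : cylindrical 0 pred0 = set0 by apply/seteqP; split.
by rewrite setYK measure0 lee_fin ltW.
Qed.

(** The approximable sets contain the cylinders and form a sigma-algebra; a countable union is first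
    truncated to a finite one. *)
Lemma measurable_approximable (mu : probability Sigma R) A :
  measurable A -> approximable mu A.
Proof.
rewrite measurable_cylE; apply: smallest_sub; last first.
  move=> _ [->|[w _ <-]]; first exact: approximable_set0.
  exact: approximable_cyl.
split.
- exact: approximable_set0.
- move=> B [mB hB]; split=> [|e /hB[n [P hP]]]; first exact: measurableD.
  exists n, (predC P); apply: le_trans hP; apply: le_measure; rewrite ?inE.
  + by apply: measurable_setY; [exact: measurableD|exact: measurable_mkseq].
  + by apply: measurable_setY => //; exact: measurable_mkseq.
  + rewrite /cylindrical /setY /setD => x /= [[[_ nB] /negP/negPn Px]|[nP nB]].
      by right.
    left; split; first by apply: contrapT => nBx; apply: nB.
    by apply/negP.
- move=> F hF; have mF i : measurable (F i) by case: (hF i).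
  pose G n := \big[setU/set0]_(i < n) F i.
  have aG n : approximable mu (G n).
    rewrite /G; elim: n => [|n IH]; first by rewrite big_ord0; exact: approximable_set0.
    by rewrite big_ord_recr; apply: approximableU.
  have mU : measurable (\bigcup_n F n) by apply: bigcupT_measurable.
  split=> // e e0; have e20 : 0 < e / 2 by rewrite divr_gt0.
  have UG : \bigcup_n G n = \bigcup_n F n.
    apply/seteqP; split=> x [n _].
      by rewrite /G -bigcup_mkord => -[i _ Fi]; exists i.
    by move=> Fn; exists n.+1 => //; rewrite /G big_ord_recr; right.
  have mG n : measurable (G n) by case: (aG n).
  have ndG : nondecreasing_seq G.
    apply/nondecreasing_seqP => n; apply/subsetPset.
    by rewrite /G big_ord_recr; left.
  (* Continuity from above: the remainders of the truncated union decrease to the empty set. *)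
  have [n hn] : exists n, (mu ((\bigcup_n F n) `\` G n) <= (e / 2)%:E)%E.
    pose H n := (\bigcup_n F n) `\` G n.
    have H0 : \bigcap_n H n = set0.
      apply/seteqP; split=> // x Hx; have [] := Hx 0%N I; rewrite -UG => -[n _ Gx] _.
      by have [] := Hx n I.
    have : mu \o H @ \oo --> mu (\bigcap_n H n).
      apply: nonincreasing_cvg_mu => //.
      - by rewrite (le_lt_trans (probability_le1 _ _)) ?ltry//; exact: measurableD.
      - by move=> n; exact: measurableD.
      - by rewrite H0.
      - by move=> n m nm; apply/subsetPset; apply: setDS; apply/subsetPset/ndG.
    rewrite H0 measure0 => /fine_cvgP[_ /cvgr_lt/(_ _ e20)[n _ /(_ n (leqnn n))]] /= h.
    exists n; rewrite -(fineK (fin_num_measure mu _ _)) ?lee_fin ?ltW//.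
    exact: measurableD.
  have [_ /(_ _ e20)[m [P hP]]] := aG n.
  exists m, P; rewrite [e]splitr EFinD; apply: le_trans (leeD hn hP).
  apply: le_trans (measureU2 _ _ _); rewrite ?inE.
  + apply: le_measure; rewrite ?inE.
    * by apply: measurable_setY => //; exact: measurable_mkseq.
    * apply: measurableU; first exact: measurableD.
      by apply: measurable_setY => //; exact: measurable_mkseq.
    * rewrite /setY /setD => x /= [[Ux nPx]|[Px nUx]].
        have [Gx|nGx] := pselect (G n x); last by left.
        by right; left.
      right; right; split=> // Gx; apply: nUx; rewrite -UG.
      by exists n.
  + exact: measurableD.
  + by apply: measurable_setY => //; exact: measurable_mkseq.
Qed.

Lemma sdist_lt (x y : Sigma) n :
  sdist R x y < 2 ^- n <-> mkseq x n.+1 = mkseq y n.+1.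
Proof.
rewrite mkseq_eqP /sdist; case: pselect => [ex|nex]; last first.
  split=> [_ i _|_]; last by rewrite invr_gt0 exprn_gt0.
  by apply/eqP/negPn/negP => ne; apply: nex; exists i.
case: ex_minnP => m mP mmin.
rewrite ltf_pV2 ?posrE ?exprn_gt0// ltr_eXn2l ?ltr1n//; split=> [nm i il|h].
  by apply/eqP/negPn/negP => /mmin; rewrite leqNgt (leq_trans il).
by rewrite ltnNge; apply/negP => /(h m) E; rewrite E eqxx in mP.
Qed.

End Approximation.

(** * Integration of bounded functions *)

Section Integration.
Context d (T : measurableType d) (R : realType).
Implicit Types (mu : probability T R) (f g : T -> R).

Definition bounded_measurable f :=
  measurable_fun setT f /\ exists B, forall x, `|f x| <= B.

Lemma bounded_measurable_integrable mu f : bounded_measurable f ->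
  mu.-integrable setT (EFin \o f).
Proof.
move=> [mf [B hB]]; apply: measurable_bounded_integrable => //.
  by rewrite (le_lt_trans (probability_le1 _ _)) ?ltry.
exists B; split; first exact: num_real.
by move=> M BM x _; apply: le_trans (hB x) (ltW BM).
Qed.
Hint Resolve bounded_measurable_integrable : core.

Lemma bounded_measurable_cst c : bounded_measurable (fun=> c).
Proof. by split=> //; exists `|c|. Qed.

Lemma bounded_measurableD f g : bounded_measurable f -> bounded_measurable g ->
  bounded_measurable (fun x => f x + g x).
Proof.
move=> [mf [B hB]] [mg [C hC]]; split; first exact: measurable_funD.
by exists (B + C) => x; apply: le_trans (ler_normD _ _) _; exact: lerD.
Qed.

Lemma bounded_measurableZ c f : bounded_measurable f ->
  bounded_measurable (fun x => c * f x).
Proof.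
move=> [mf [B hB]]; split; first exact: measurable_funM.
by exists (`|c| * B) => x; rewrite normrM ler_wpM2l.
Qed.

Lemma bounded_measurableB f g : bounded_measurable f -> bounded_measurable g ->
  bounded_measurable (fun x => f x - g x).
Proof.
move=> [mf [B hB]] [mg [C hC]]; split; first exact: measurable_funB.
by exists (B + C) => x; apply: le_trans (ler_normB _ _) _; exact: lerD.
Qed.

Lemma bounded_measurable_sum (I : Type) (s : seq I) (F : I -> T -> R) :
  (forall i, bounded_measurable (F i)) ->
  bounded_measurable (fun x => \sum_(i <- s) F i x).
Proof.
move=> bF; elim: s => [|i s IH].
  under eq_fun do rewrite big_nil.
  exact: bounded_measurable_cst.
under eq_fun do rewrite big_cons.
exact: bounded_measurableD.
Qed.

Lemma Rintegral_probability_cst mu c : \int[mu]_x c = c.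
Proof. by rewrite Rintegral_cst//= probability_setT /= mulr1. Qed.

Lemma Rintegral_sum mu (I : Type) (s : seq I) (F : I -> T -> R) :
  (forall i, bounded_measurable (F i)) ->
  \int[mu]_x (\sum_(i <- s) F i x) = \sum_(i <- s) \int[mu]_x F i x.
Proof.
move=> bF; elim: s => [|i s IH].
  rewrite big_nil -[RHS](Rintegral_probability_cst mu).
  by apply: eq_Rintegral => x _; rewrite big_nil.
rewrite big_cons -IH -RintegralD//; last 2 first.
- by apply: bounded_measurable_integrable.
- by apply: bounded_measurable_integrable; exact: bounded_measurable_sum.
by apply: eq_Rintegral => x _; rewrite big_cons.
Qed.

Lemma le_Rintegral_bounded mu f g : bounded_measurable f ->
  bounded_measurable g -> (forall x, f x <= g x) ->
  \int[mu]_x f x <= \int[mu]_x g x.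
Proof.
by move=> bf bg fg; apply: le_Rintegral => //; exact: bounded_measurable_integrable.
Qed.

Lemma EFin_Rintegral mu f : bounded_measurable f ->
  (\int[mu]_x (f x)%:E)%E = (\int[mu]_x f x)%:E.
Proof.
move=> /(bounded_measurable_integrable mu) /integrable_fin_num; rewrite /Rintegral.
by move=> h; rewrite fineK// h.
Qed.

Lemma bounded_measurable_indic (A : set T) : measurable A ->
  bounded_measurable (\1_A : T -> R).
Proof.
move=> mA; split; first exact: measurable_indic.
by exists 1 => x; rewrite indicE; case: (_ \in _); rewrite ?normr1 ?normr0.
Qed.

Lemma Rintegral_indic_probability mu (A : set T) : measurable A ->
  \int[mu]_x \1_A x = fine (mu A).
Proof. by move=> mA; rewrite /Rintegral integral_indic// setIT. Qed.

Definition measurable_label (I : finType) (L : T -> I) :=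
  forall i, measurable (L @^-1` [set i]).

Lemma measurable_label_comp (I J : finType) (L : T -> I) (h : I -> J) :
  measurable_label L -> measurable_label (h \o L).
Proof.
move=> mL j.
have -> : (h \o L) @^-1` [set j] =
    \bigcup_(i in [set i | h i = j]) L @^-1` [set i].
  by apply/seteqP; split=> [x <-|x [i /= <- <-]//]; exists (L x).
by apply: fin_bigcup_measurable => //; exact: finite_finset.
Qed.

Lemma measurable_label_pair (I J : finType) (L : T -> I) (L' : T -> J) :
  measurable_label L -> measurable_label L' ->
  measurable_label (fun x => (L x, L' x)).
Proof.
move=> mL mL' [i j].
have -> : (fun x => (L x, L' x)) @^-1` [set (i, j)] =
    (L @^-1` [set i]) `&` (L' @^-1` [set j]).
  by apply/seteqP; split=> [x [<- <-]|x [/= <- <-]].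
exact: measurableI.
Qed.

Lemma finite_valuedE (I : finType) (L : T -> I) (c : I -> R) :
  (fun x => c (L x)) = (fun x => \sum_(i : I) c i * \1_(L @^-1` [set i]) x).
Proof.
apply/funext => x; rewrite (bigD1 (L x))//= indicE mem_set// mulr1 big1 ?addr0//.
by move=> i ne; rewrite indicE memNset ?mulr0// => /= e; rewrite e eqxx in ne.
Qed.

Lemma bounded_measurable_label (I : finType) (L : T -> I) (c : I -> R) :
  measurable_label L -> bounded_measurable (fun x => c (L x)).
Proof.
move=> mL; split; last first.
  exists (\sum_i `|c i|) => x; rewrite (bigD1 (L x))//= lerDl.
  by apply: sumr_ge0.
rewrite finite_valuedE.
apply: measurable_sum => i; apply: measurable_funM => //.
Qed.

(** Turns sums such as those of p ln q in a cross entropy into integrals of ln q along the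
    labelling, which can then be compared pointwise with Birkhoff sums. *)
Lemma Rintegral_label mu (I : finType) (L : T -> I) (c : I -> R) :
  measurable_label L ->
  \int[mu]_x c (L x) = \sum_i c i * fine (mu (L @^-1` [set i])).
Proof.
move=> mL; rewrite finite_valuedE Rintegral_sum => [|i]; last first.
  apply: bounded_measurableZ; exact: bounded_measurable_indic.
apply: eq_bigr => i _; rewrite RintegralZl//; last first.
  by apply: bounded_measurable_integrable; exact: bounded_measurable_indic.
by rewrite Rintegral_indic_probability.
Qed.

Lemma sum_label_probability mu (I : finType) (L : T -> I) :
  measurable_label L -> \sum_i fine (mu (L @^-1` [set i])) = 1.
Proof.
move=> mL; rewrite -[RHS](Rintegral_probability_cst mu).
by rewrite (Rintegral_label mu (fun=> 1) mL); under [RHS]eq_bigr do rewrite mul1r.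
Qed.

Lemma fineK_probability mu (A : set T) : measurable A ->
  (fine (mu A))%:E = mu A.
Proof. by move=> mA; rewrite fineK// fin_num_measure. Qed.

Lemma fine_probability_le mu (A : set T) (e : R) : measurable A ->
  (mu A <= e%:E)%E -> fine (mu A) <= e.
Proof. by move=> mA; rewrite -lee_fin fineK_probability. Qed.

Lemma fine_probability_itv mu (A : set T) : measurable A ->
  0 <= fine (mu A) <= 1.
Proof.
by move=> mA; rewrite fine_ge0//= fine_probability_le// probability_le1.
Qed.

End Integration.
#[local] Hint Resolve bounded_measurable_integrable : core.

Section ShiftIntegration.
Variable R : realType.
Implicit Types (mu : probability Sigma R) (f : Sigma -> R).

Lemma bounded_measurable_iter i f : bounded_measurable f ->
  bounded_measurable (fun x => f (iter i shift x)).
Proof.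
move=> [mf [B hB]]; split; last by exists B => x; exact: hB.
elim: i => //= i IH.
have -> : (fun x => f (shift (iter i shift x))) =
          (fun x => f (iter i shift x)) \o shift.
  by apply/funext => x /=; rewrite -iterSr.
by apply: measurableT_comp => //; exact: measurable_shift.
Qed.

Lemma Rintegral_shift mu f : invariant mu -> bounded_measurable f ->
  \int[mu]_x f (shift x) = \int[mu]_x f x.
Proof.
move=> imu bf; rewrite /Rintegral; congr fine.
transitivity (\int[pushforward mu shift]_x (f x)%:E)%E.
  rewrite [RHS](integral_pushforward measurable_shift)//.
  - by apply/measurable_EFinP; case: bf.
  - apply: (@bounded_measurable_integrable _ _ _ mu (f \o shift)).
    exact: (bounded_measurable_iter 1 bf).
apply: eq_measure_integral => [|mS A mA _]; first exact: measurable_shift.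
exact: imu.
Qed.

Lemma Rintegral_iter mu f i : invariant mu -> bounded_measurable f ->
  \int[mu]_x f (iter i shift x) = \int[mu]_x f x.
Proof.
move=> imu bf; elim: i => //= i <-.
rewrite -[RHS]Rintegral_shift//; last exact: bounded_measurable_iter.
by apply: eq_Rintegral => x _; rewrite -iterSr.
Qed.

End ShiftIntegration.

(** * Entropy bounds from weights on words *)

Section Labels.
Variable R : realType.
Implicit Types (mu : probability Sigma R).

Lemma projE n (x : Sigma) : proj n x = mkseq x n :> seq bool.
Proof. by rewrite /proj /= /mkseq -val_enum_ord -map_comp; apply: eq_map. Qed.

Lemma preimage_projE n (w : n.-tuple bool) : proj n @^-1` [set w] = cyl w.
Proof.
apply/seteqP; split=> x /=; first by move=> <-; rewrite projE cyl_mkseq.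
by rewrite cylE size_tuple => e; apply: val_inj; rewrite /= projE.
Qed.

Lemma measurable_proj n : measurable_label (proj n).
Proof. by move=> w; rewrite preimage_projE; exact: measurable_cyl. Qed.

Lemma mkseq_window i n L (x : Sigma) : (i <= n)%N ->
  take L (drop i (mkseq x (n + L))) = mkseq (iter i shift x) L.
Proof.
move=> le; rewrite /mkseq -map_drop -map_take drop_iota take_iota add0n.
rewrite (minn_idPl _); last by rewrite -addnBAC// leq_addl.
rewrite -[X in iota X](addn0 i) iotaDl -map_comp; apply: eq_map => j /=.
by rewrite iter_shiftE.
Qed.

Definition itinerary (I : finType) (xi : Sigma -> I) n (x : Sigma) :
  {ffun 'I_n -> I} := [ffun i : 'I_n => xi (iter i shift x)].

Lemma itineraryP (I : finType) (xi : Sigma -> I) n w :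
  itinerary xi n @^-1` [set w] =
  [set x | forall i : 'I_n, xi (iter i shift x) = w i].
Proof.
apply/seteqP; split=> x /=; first by move=> <- i; rewrite ffunE.
by move=> h; apply/ffunP => i; rewrite ffunE.
Qed.

Lemma measurable_label_iter (I : finType) (xi : Sigma -> I) i :
  measurable_label xi -> measurable_label (fun x => xi (iter i shift x)).
Proof.
move=> mxi; elim: i => //= i IH j.
have -> : (fun x => xi (shift (iter i shift x))) @^-1` [set j] =
    shift @^-1` ((fun x => xi (iter i shift x)) @^-1` [set j]).
  by apply/seteqP; split=> x /=; rewrite -iterSr.
rewrite -[X in measurable X]setTI; apply: measurable_shift => //; exact: IH.
Qed.

Lemma measurable_itinerary (I : finType) (xi : Sigma -> I) n :
  measurable_label xi -> measurable_label (itinerary xi n).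
Proof.
move=> mxi w; rewrite itineraryP.
have -> : [set x | forall i : 'I_n, xi (iter i shift x) = w i] =
    \bigcap_(i in [set: 'I_n]) (fun x => xi (iter i shift x)) @^-1` [set w i].
  by apply/seteqP; split=> [x h i _|x h i] /=; [exact: h|exact: h].
apply: fin_bigcap_measurable => [|i _]; first exact: finite_finset.
exact: measurable_label_iter.
Qed.

Lemma refined_probE mu k (xi : Sigma -> 'I_k) n w :
  refined_prob mu xi w = fine (mu (itinerary xi n @^-1` [set w])).
Proof. by rewrite itineraryP. Qed.

(** Each atom of [xi] is approximated by a cylindrical set up to [eta / k], and [g] selects any atom
    whose approximation contains the point; a wrong label puts the point in one of the [k] symmetric
    differences. *)
Lemma approx_label mu k (xi : Sigma -> 'I_k) (eta : R) :
  measurable_label xi -> 0 < eta ->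
  exists L (g : seq bool -> 'I_k),
    \int[mu]_x (g (mkseq x L) != xi x)%:R <= eta.
Proof.
move=> mxi eta0.
have k0 : (0 < k)%N by case: (xi zero_bar) => i; apply: leq_ltn_trans.
have ek0 : 0 < eta / k%:R by rewrite divr_gt0 ?ltr0n.
have /choice[nP hnP] (a : 'I_k) : exists nP : nat * pred (seq bool),
    (mu ((xi @^-1` [set a]) `+` cylindrical nP.1 nP.2) <= (eta / k%:R)%:E)%E.
  have [_ /(_ _ ek0)[n [P h]]] := measurable_approximable mu (mxi a).
  by exists (n, P).
pose L := (\max_(a : 'I_k) (nP a).1)%N.
pose B a w := (nP a).2 (take (nP a).1 w).
have hB a x : B a (mkseq x L) = (nP a).2 (mkseq x (nP a).1).
  rewrite /B /mkseq -map_take take_iota (minn_idPl _)//.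
  exact: (leq_bigmax (F := fun a => (nP a).1)).
pose g w := odflt (xi zero_bar) [pick a | B a w].
exists L, g.
pose D a := (xi @^-1` [set a]) `+` cylindrical (nP a).1 (nP a).2.
have mD a : measurable (D a).
  by apply: measurable_setY; [exact: mxi|exact: measurable_mkseq].
apply: (@le_trans _ _ (\int[mu]_x \sum_(a : 'I_k) \1_(D a) x)); last first.
  rewrite Rintegral_sum; last by move=> a; exact: bounded_measurable_indic.
  apply: (@le_trans _ _ (\sum_(a : 'I_k) eta / k%:R)); last first.
    by rewrite sumr_const card_ord -[X in X <= _]mulr_natr mulfVK// pnatr_eq0 -lt0n.
  apply: ler_sum => a _; rewrite Rintegral_indic_probability//.
  apply: fine_probability_le; [exact: mD|exact: hnP].
apply: le_Rintegral_bounded.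
- pose L1 x := (proj L x, xi x).
  have -> : (fun x => (g (mkseq x L) != xi x)%:R) =
     (fun x => ((fun p : L.-tuple bool * 'I_k => (g p.1 != p.2)%:R : R) (L1 x))).
    by apply/funext => x /=; rewrite projE.
  apply: (@bounded_measurable_label _ _ _ _ L1 (fun p => (g p.1 != p.2)%:R)).
  by apply: measurable_label_pair => //; exact: measurable_proj.
- apply: bounded_measurable_sum => a; exact: bounded_measurable_indic.
move=> x; case: eqP => [_|ne]; first by rewrite sumr_ge0// => a _; rewrite indicE.
have [a Da] : exists a, D a x.
  apply: contrapT => /forallNP nD; apply: ne; rewrite /g.
  case: pickP => [a|h] /=.
    rewrite hB => Pa; apply/esym; apply: contrapT => xia.
    by apply: (nD a); right; split.
  exfalso; apply: (nD (xi x)); left; split=> //.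
  by rewrite /cylindrical /= -hB h.
rewrite (bigD1 a)//= indicE mem_set// lerDl sumr_ge0// => b _.
Qed.

End Labels.

Section CrossEntropy.
Variable R : realType.

(** Gibbs' inequality for weights [q] of total at most [C], from ln (1 + x) <= x. The additive
    constant disappears after division by the length of the words. *)
Lemma shannon_le_cross (I : finType) (p q : I -> R) (C : R) :
  (forall i, 0 <= p i) -> (forall i, 0 < q i) -> \sum_i q i <= C ->
  shannon p <= - (\sum_i p i * ln (q i)) + C.
Proof.
move=> p0 q0 qC; apply: le_trans (_ : _ <= - (\sum_i p i * ln (q i)) + \sum_i q i) _.
  rewrite /shannon -!sumrN -big_split /=; apply: ler_sum => i _.
  have := p0 i; rewrite le_eqVlt => /orP[/eqP <-|pi0].
    by rewrite !mul0r oppr0 add0r ltW.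
  have := @le_ln1Dx R (q i / p i - 1) _.
  rewrite [1 + (_ - 1)]addrC subrK ltrBrDl subrr divr_gt0 ?q0// => /(_ isT).
  rewrite ln_div ?posrE ?q0// => h.
  have : p i * (ln (q i) - ln (p i)) <= p i * (q i / p i - 1) by rewrite ler_pM2l.
  rewrite !mulrBr mulr1 [p i * (q i / p i)]mulrCA divff ?gt_eqF//.
  lra.
by rewrite lerD2l.
Qed.

Lemma shannon_ge0 (I : finType) (p : I -> R) :
  (forall i, 0 <= p i <= 1) -> 0 <= shannon p.
Proof.
move=> p01; rewrite /shannon oppr_ge0; apply: sumr_le0 => i _.
by have /andP[p0 p1] := p01 i; rewrite mulr_ge0_le0// ln_le0.
Qed.

Lemma ln_prod n (F : 'I_n -> R) : (forall i, 0 < F i) ->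
  ln (\prod_(i < n) F i) = \sum_(i < n) ln (F i).
Proof.
move=> F0; elim: n F F0 => [|n IH] F F0; first by rewrite !big_ord0 ln1.
by rewrite !big_ord_recr /= lnM ?posrE ?prodr_gt0// IH.
Qed.

End CrossEntropy.

Section EntropyUpper.
Variable R : realType.
Implicit Types (mu : probability Sigma R) (psi : Sigma -> R).

Definition birkhoff psi n x := \sum_(i < n) psi (iter i shift x).

Lemma bounded_measurable_birkhoff psi n : bounded_measurable psi ->
  bounded_measurable (birkhoff psi n).
Proof.
by move=> bp; apply: bounded_measurable_sum => i; exact: bounded_measurable_iter.
Qed.

Lemma Rintegral_birkhoff mu psi n : invariant mu -> bounded_measurable psi ->
  \int[mu]_x birkhoff psi n x = n%:R * \int[mu]_x psi x.
Proof.
move=> imu bp; rewrite Rintegral_sum; last first.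
  by move=> i; exact: bounded_measurable_iter.
under eq_bigr do rewrite Rintegral_iter//.
by rewrite sumr_const card_ord mulr_natl.
Qed.

Variables (mu : probability Sigma R) (psi : Sigma -> R).
Variables (m : seq bool -> R) (C : R).
Hypothesis imu : invariant mu.
Hypothesis bpsi : bounded_measurable psi.
Hypothesis m_gt0 : forall w, 0 < m w.
Hypothesis m_sum : forall n, \sum_(w : n.-tuple bool) m w <= C.
Hypothesis m_ge : forall n x, birkhoff psi n x <= ln (m (mkseq x n)) + C.

(** The law of the itineraries is compared, by Gibbs' inequality, with weights derived from [m]: the
    weight of a word is bounded below through the Birkhoff sum of [psi], recovering the labels costs
    at most [e] per letter on average, and whatever does not grow with [n] goes into [D]. *)
Lemma shannon_refined_le k (xi : Sigma -> 'I_k) (e : R) :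
  measurable_label xi -> 0 < e ->
  exists D : R, forall n,
    shannon (refined_prob mu xi (n := n)) <= n%:R * (e - \int[mu]_x psi x) + D.
Proof.
move=> mxi e0.
have k0 : (0 < k)%N by case: (xi zero_bar) => i; apply: leq_ltn_trans.
have kR : 0 < k%:R :> R by rewrite ltr0n.
(* With corruption probability [d], a correct label costs at most - ln (1 - d) = e / 2 and a wrong
   one costs [l]; an error rate of at most [e / 2 / l] keeps the mean cost below [e]. *)
pose d : R := 1 - expR (- (e / 2)).
have ed : expR (- (e / 2)) < 1 by rewrite expR_lt1 oppr_lt0 divr_gt0.
have d0 : 0 < d by rewrite subr_gt0.
have d1 : d < 1 by rewrite ltrBlDr ltrDl expR_gt0.
have dk0 : 0 < d / k%:R by rewrite divr_gt0.
have dk1 : d / k%:R < 1.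
  by rewrite ltr_pdivrMr// mul1r (lt_le_trans d1)// ler1n.
pose l := - ln (d / k%:R).
have l0 : 0 < l by rewrite oppr_gt0 ln_lt0// dk0.
have [L [g hg]] := @approx_label R mu k xi (e / 2 / l) mxi
  (divr_gt0 (divr_gt0 e0 (ltr0n _ 2)) l0).
(* The reference weights [Q] read the labels of a word drawn from [m] through the cylinder
   approximation [g] and corrupt each of them with probability [d]; this plays the role of the
   theorem on generators. *)
pose K (a b : 'I_k) : R := d / k%:R + (1 - d) * (a == b)%:R.
have K0 a b : 0 < K a b.
  by rewrite ltr_pwDl// mulr_ge0// subr_ge0 ltW.
have Ksum a : \sum_b K a b = 1.
  rewrite big_split /= sumr_const card_ord -[X in X + _]mulr_natr divfK ?gt_eqF//.
  rewrite (bigD1 a)//= eqxx mulr1 big1 ?addr0 ?subrKC// => b ne.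
  by rewrite eq_sym (negbTE ne) mulr0.
pose kap (x : Sigma) := ln (K (g (mkseq x L)) (xi x)).
have bkap : bounded_measurable kap.
  pose L1 x := (proj L x, xi x).
  have -> : kap = (fun x => ((fun p : L.-tuple bool * 'I_k => ln (K (g p.1) p.2)) (L1 x))).
    by apply/funext => x; rewrite /kap /= projE.
  apply: (@bounded_measurable_label _ _ _ _ L1 (fun p => ln (K (g p.1) p.2))).
  by apply: measurable_label_pair => //; exact: measurable_proj.
have bne : bounded_measurable (fun x : Sigma => (g (mkseq x L) != xi x)%:R : R).
  pose L1 x := (proj L x, xi x).
  have -> : (fun x => (g (mkseq x L) != xi x)%:R) =
     (fun x => ((fun p : L.-tuple bool * 'I_k => (g p.1 != p.2)%:R : R) (L1 x))).
    by apply/funext => x /=; rewrite projE.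
  apply: (@bounded_measurable_label _ _ _ _ L1 (fun p => (g p.1 != p.2)%:R)).
  by apply: measurable_label_pair => //; exact: measurable_proj.
have ikap : - e <= \int[mu]_x kap x.
  apply: (@le_trans _ _ (\int[mu]_x (- (e / 2) + (- l) * (g (mkseq x L) != xi x)%:R))).
    rewrite RintegralD//; last 2 first.
    - by apply: bounded_measurable_integrable; exact: bounded_measurable_cst.
    - by apply: bounded_measurable_integrable; exact: bounded_measurableZ.
    rewrite Rintegral_probability_cst RintegralZl//; last first.
      exact: bounded_measurable_integrable.
    rewrite {1}[e]splitr opprD lerD2l mulNr lerN2.
    by rewrite mulrC -ler_pdivlMr.
  apply: le_Rintegral_bounded => //.
    apply: bounded_measurableD; first exact: bounded_measurable_cst.
    exact: bounded_measurableZ.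
  move=> x; rewrite /kap /K; case: eqP => /= _.
    rewrite mulr0 addr0 mulr1 -(expRK (- (e / 2))) ler_ln ?posrE ?expR_gt0//.
      by rewrite /d subKr lerDr ltW.
    by rewrite ltr_pwDl// subr_ge0 ltW.
  rewrite mulr1 mulr0 addr0 /l opprK gerDr.
  by rewrite oppr_le0 divr_ge0// ltW.
(* Summed over the labels first, the rows of the stochastic kernel [K] give 1, and the total of [m]
   remains. *)
have Q_sum n : \sum_(u : {ffun 'I_n -> 'I_k}) \sum_(w : (n + L).-tuple bool)
    m w * \prod_(i < n) K (g (take L (drop i w))) (u i) <= C.
  rewrite exchange_big /=; apply: le_trans (m_sum (n + L)).
  apply: ler_sum => w _; rewrite -mulr_sumr.
  rewrite -(bigA_distr_bigA (fun (i : 'I_n) (b : 'I_k) => K (g (take L (drop i w))) b)) /=.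
  by rewrite big1 ?mulr1// => i _; rewrite Ksum.
have [_ [B hB]] := bpsi.
(* One [B] for each of the [L] letters that the last windows read beyond [n], one [C] from [m_ge],
   and one from the total of the weights. *)
exists (L%:R * B + C + C) => n.
pose Q (u : {ffun 'I_n -> 'I_k}) := \sum_(w : (n + L).-tuple bool)
    m w * \prod_(i < n) K (g (take L (drop i w))) (u i).
have term0 (w : (n + L).-tuple bool) (u : {ffun 'I_n -> 'I_k}) :
    0 < m w * \prod_(i < n) K (g (take L (drop i w))) (u i).
  by rewrite mulr_gt0// prodr_gt0.
have Q_ge x : m (mkseq x (n + L)) *
    \prod_(i < n) K (g (mkseq (iter i shift x) L)) (xi (iter i shift x))
    <= Q (itinerary xi n x).
  rewrite /Q (bigD1 (proj (n + L) x))//= [X in X <= _](_ : _ =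
    m (proj (n + L) x) * \prod_(i < n) K (g (take L (drop i (proj (n + L) x))))
      (itinerary xi n x i)).
    by rewrite lerDl sumr_ge0// => w _; exact: ltW.
  rewrite projE; congr (_ * _); apply: eq_bigr => i _.
  by rewrite ffunE mkseq_window// ltnW.
have Q0 u : 0 < Q u.
  rewrite /Q (bigD1 (proj (n + L) zero_bar))//.
  apply: ltr_pwDl; first exact: term0.
  by apply: sumr_ge0 => w _; exact: ltW.
have bQ : bounded_measurable (fun x => ln (Q (itinerary xi n x))).
  apply: (@bounded_measurable_label _ _ _ _ (itinerary xi n) (fun u => ln (Q u))).
  exact: measurable_itinerary.
have -> : shannon (refined_prob mu xi (n := n)) =
    shannon (fun w => fine (mu (itinerary xi n @^-1` [set w]))).
  by congr shannon; apply/funext => w; rewrite refined_probE.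
apply: le_trans (@shannon_le_cross R _ _ Q C _ Q0 (Q_sum n)) _.
  by move=> w; rewrite fine_ge0.
rewrite -/(Q _) addrA lerD2r.
under eq_bigr do rewrite mulrC.
rewrite -(Rintegral_label mu (fun u => ln (Q u))); last exact: measurable_itinerary.
have key : \int[mu]_x (birkhoff psi n x + (birkhoff kap n x + - (L%:R * B + C))) <=
    \int[mu]_x ln (Q (itinerary xi n x)).
  apply: le_Rintegral_bounded => //.
    apply: bounded_measurableD; first exact: bounded_measurable_birkhoff.
    apply: bounded_measurableD; first exact: bounded_measurable_birkhoff.
    exact: bounded_measurable_cst.
  move=> x; apply: le_trans (_ : ln (m (mkseq x (n + L)) *
    \prod_(i < n) K (g (mkseq (iter i shift x) L)) (xi (iter i shift x))) <= _).
    rewrite lnM ?posrE ?m_gt0 ?prodr_gt0// ln_prod//.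
    rewrite -/(birkhoff kap n x) [X in _ <= X]addrC [X in X <= _]addrCA lerD2l.
    have := m_ge (n + L) x; rewrite /birkhoff big_split_ord /=.
    set S2 := \sum_(i < L) _.
    have : - (L%:R * B) <= S2.
      apply: (@le_trans _ _ (\sum_(i < L) - B)).
        by rewrite sumrN sumr_const card_ord mulr_natl.
      by apply: ler_sum => i _; have := hB (iter (n + i) shift x);
        rewrite ler_norml => /andP[].
    lra.
  by rewrite ler_ln ?posrE// mulr_gt0// prodr_gt0.
rewrite RintegralD in key; last 3 first.
- by [].
- by apply: bounded_measurable_integrable; exact: bounded_measurable_birkhoff.
- apply: bounded_measurable_integrable; apply: bounded_measurableD.
    exact: bounded_measurable_birkhoff.
  exact: bounded_measurable_cst.
rewrite RintegralD in key; last 3 first.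
- by [].
- by apply: bounded_measurable_integrable; exact: bounded_measurable_birkhoff.
- by apply: bounded_measurable_integrable; exact: bounded_measurable_cst.
rewrite Rintegral_probability_cst !Rintegral_birkhoff// in key.
have : n%:R * (- e) <= n%:R * \int[mu]_x kap x by rewrite ler_wpM2l.
lra.
Qed.

Lemma entropy_le_of_weights : (entropy mu <= (- \int[mu]_x psi x)%:E)%E.
Proof.
apply: ge_ereal_sup => _ [k [xi [mxi ->]]]; rewrite lee_fin.
apply/ler_addgt0Pr => e e0; set a := - _.
have e20 : 0 < e / 2 by rewrite divr_gt0.
have [D hD] := shannon_refined_le mxi e20.
pose H n := shannon (refined_prob mu xi (n := n)).
have [N hN] : exists N, forall n, (N <= n)%N -> H n / n%:R <= a + e.
  exists (Num.bound (`|D| / (e / 2))).+1 => n le.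
  have n0 : (0 < n)%N by apply: leq_trans le.
  rewrite ler_pdivrMr ?ltr0n//; apply: le_trans (hD n) _.
  have : D <= n%:R * (e / 2).
    apply: le_trans (ler_norm _) _; rewrite -ler_pdivrMr//.
    apply: le_trans (ltW (archi_boundP _)) _; first by rewrite divr_ge0// ltW.
    by rewrite ler_nat ltnW.
  rewrite -/a; lra.
rewrite /entropy_partition; have [cv|ncv] := pselect (cvgn (fun n => H n / n%:R)).
  by apply: limr_le => //; exists N => // n /= /hN.
(* A divergent [limn] takes the default value 0, which lies below [H N / N] because Shannon
   entropies of probabilities are nonnegative. *)
rewrite (dvgP ncv); apply: le_trans (hN N (leqnn N)).
rewrite divr_ge0//; apply: shannon_ge0 => w; rewrite refined_probE.
by apply: fine_probability_itv; exact: measurable_itinerary.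
Qed.

End EntropyUpper.

Section EntropyLower.
Variable R : realType.

Definition bit_label (x : Sigma) : 'I_2 := inord (x 0%N).

Lemma measurable_bit_label : measurable_label bit_label.
Proof.
have -> : bit_label = (fun w : 1.-tuple bool => inord (head false w)) \o proj 1.
  by apply/funext => x; rewrite /bit_label [RHS]/comp projE.
by apply: measurable_label_comp; exact: measurable_proj.
Qed.

Lemma itinerary_bit_label n x :
  itinerary bit_label n @^-1` [set itinerary bit_label n x] = cyl (mkseq x n).
Proof.
apply/seteqP; split=> y; rewrite cyl_mkseq mkseq_eqP => /=.
  move=> /ffunP h i il; have := congr1 val (h (Ordinal il)).
  rewrite !ffunE /bit_label !iter_shiftE /= addn0.
  by rewrite !inordK ?ltnS ?leq_b1//; case: (x i); case: (y i).
move=> h; apply/ffunP => i.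
by rewrite !ffunE /bit_label !iter_shiftE addn0 h.
Qed.

Variables (mu : probability Sigma R) (psi : Sigma -> R).
Variables (m : seq bool -> R) (C : R).
Hypothesis imu : invariant mu.
Hypothesis bpsi : bounded_measurable psi.
Hypothesis m_gt0 : forall w, 0 < m w.
Hypothesis m_sum : forall n, \sum_(w : n.-tuple bool) m w <= C.
Hypothesis m_ge : forall n x, birkhoff psi n x <= ln (m (mkseq x n)) + C.
Hypothesis mu_gt0 : forall w, (0 < mu (cyl w))%E.
Hypothesis mu_le : forall n x,
  (mu (cyl (mkseq x n)) <= (expR (birkhoff psi n x + C))%:E)%E.

(** The partition by the first letter already attains the bound: its itineraries are the cylinders,
    so [mu_le] bounds [H n] below by [n * a - C], and [shannon_refined_le] bounds it above at the
    same linear rate. *)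
Lemma entropy_of_weights : entropy mu = (- \int[mu]_x psi x)%:E.
Proof.
apply/eqP; rewrite eq_le (entropy_le_of_weights imu bpsi m_gt0 m_sum m_ge) /=.
set a := - _.
have -> : a = entropy_partition mu bit_label; last first.
  apply: ereal_sup_ubound; exists 2%N, bit_label; split=> //.
  exact: measurable_bit_label.
pose H n := shannon (refined_prob mu bit_label (n := n)).
have H_ge n : n%:R * a - C <= H n.
  rewrite /H /shannon lerNr opprB.
  under eq_bigr do rewrite refined_probE mulrC.
  rewrite -(Rintegral_label mu (fun u =>
    ln (fine (mu (itinerary bit_label n @^-1` [set u]))))); last first.
    by apply: measurable_itinerary; exact: measurable_bit_label.
  apply: (@le_trans _ _ (\int[mu]_x (birkhoff psi n x + C))).
    apply: le_Rintegral_bounded.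
    - apply: (@bounded_measurable_label _ _ _ _ (itinerary bit_label n)
        (fun u => ln (fine (mu (itinerary bit_label n @^-1` [set u]))))).
      by apply: measurable_itinerary; exact: measurable_bit_label.
    - apply: bounded_measurableD.
        exact: bounded_measurable_birkhoff.
      exact: bounded_measurable_cst.
    - move=> x; rewrite itinerary_bit_label.
      have mc := measurable_cyl (mkseq x n).
      have p0 : 0 < fine (mu (cyl (mkseq x n))).
        by rewrite -lte_fin fineK_probability.
      rewrite -[X in _ <= X]expRK ler_ln ?posrE ?expR_gt0//.
      exact: fine_probability_le.
  rewrite RintegralD//; last 2 first.
  - by apply: bounded_measurable_integrable; exact: bounded_measurable_birkhoff.
  - by apply: bounded_measurable_integrable; exact: bounded_measurable_cst.
  rewrite Rintegral_probability_cst Rintegral_birkhoff// /a.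
  lra.
apply/esym/cvg_lim => //; apply/cvgrPdist_le => e e0.
have e20 : 0 < e / 2 by rewrite divr_gt0.
have [D hD] := shannon_refined_le imu bpsi m_gt0 m_sum m_ge measurable_bit_label e20.
exists (Num.bound ((`|C| + `|D|) / (e / 2))).+1 => // n /= le.
have n0 : (0 < n)%N by apply: leq_trans le.
have nR : 0 < n%:R :> R by rewrite ltr0n.
have : `|C| + `|D| <= n%:R * (e / 2).
  rewrite -ler_pdivrMr//.
  apply: le_trans (ltW (archi_boundP _)) _.
    by rewrite divr_ge0 ?addr_ge0// ltW.
  by rewrite ler_nat ltnW.
have := hD n; have := H_ge n; rewrite -/(H n) -/a.
have := ler_norm C; have := ler_norm D; have := normr_ge0 C; have := normr_ge0 D.
move=> h1 h2 h3 h4 h5 h6 h7.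
rewrite ler_distlC; apply/andP; split.
  rewrite ler_pdivlMr//; lra.
rewrite ler_pdivrMr//; lra.
Qed.

End EntropyLower.

(** * Measures with prescribed cylinder probabilities *)

Section UnitInterval.
Variable R : realType.

Let unit_itv : set (measurableTypeR R) := [set` `[0, 1[%R].

Let measurable_unit_itv : measurable unit_itv.
Proof. exact: measurable_itv. Qed.

Definition unit_lebesgue : set (measurableTypeR R) -> \bar R :=
  mrestr (@lebesgue_measure R) measurable_unit_itv.

HB.instance Definition _ := Measure.on unit_lebesgue.

Let unit_lebesgue_setT : unit_lebesgue setT = 1%E.
Proof.
by rewrite /unit_lebesgue /mrestr setTI lebesgue_measure_itv/= lte_fin ltr01 oppr0 adde0.
Qed.

HB.instance Definition _ :=
  Measure_isProbability.Build _ _ _ unit_lebesgue unit_lebesgue_setT.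

Lemma unit_lebesgue_itv (P : R -> Prop) (a b : R) : 0 <= a -> a <= b -> b <= 1 ->
  (forall t, 0 <= t < 1 -> P t <-> a <= t < b) ->
  unit_lebesgue [set t | P t] = (b - a)%:E.
Proof.
move=> a0 ab b1 h; rewrite /unit_lebesgue /mrestr.
have -> : [set t | P t] `&` unit_itv = [set` `[a, b[%R].
  apply/seteqP; split=> t /=; rewrite !in_itv /=; first by case=> Pt t01; apply/(h t t01).
  move=> /andP[at0 tb]; have t01 : 0 <= t < 1.
    by rewrite (le_trans a0)// (lt_le_trans tb).
  by split=> //; apply/(h t t01)/andP.
rewrite lebesgue_measure_itv/= lte_fin; case: ltP => // ba.
by rewrite (@le_anti _ _ a b) ?subrr// ab.
Qed.

End UnitInterval.

Section MeasureOfWeights.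
Variables (R : realType) (m : seq bool -> R).
Hypothesis m_ge0 : forall w, 0 <= m w.
Hypothesis m_nil : m [::] = 1.
Hypothesis m_rcons : forall w, m (rcons w false) + m (rcons w true) = m w.

(* [left_end w, left_end w + m w) is the interval coding the cylinder of [w]. *)
Definition left_end (w : seq bool) : R :=
  (foldl (fun p b => (rcons p.1 b, p.2 + if b then m (rcons p.1 false) else 0))
     ([::], 0) w).2.

Lemma left_end_rcons w b :
  left_end (rcons w b) = left_end w + if b then m (rcons w false) else 0.
Proof.
rewrite /left_end; set f := (F in foldl F).
have E v : (foldl f ([::], 0) v).1 = v.
  by elim/last_ind: v => // v c IH; rewrite foldl_rcons /= IH.
by rewrite foldl_rcons /= E.
Qed.

Lemma left_end_bounds w : 0 <= left_end w /\ left_end w + m w <= 1.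
Proof.
elim/last_ind: w => [|w b [IH0 IH1]].
  by rewrite /left_end /= add0r m_nil.
have := m_rcons w; have := m_ge0 (rcons w false); have := m_ge0 (rcons w true).
by rewrite left_end_rcons; case: b => h1 h2 h3; split; lra.
Qed.

Fixpoint code_word (t : R) n : seq bool :=
  if n is k.+1 then let w := code_word t k in
    rcons w (left_end w + m (rcons w false) <= t)
  else [::].

Definition code (t : measurableTypeR R) : Sigma :=
  fun n => last false (code_word t n.+1).

Lemma mkseq_code t n : mkseq (code t) n = code_word t n.
Proof.
by elim: n => // n IH; rewrite mkseqS IH /code /= last_rcons.
Qed.

Lemma code_cylP (t : R) w : 0 <= t < 1 ->
  cyl w (code t) <-> left_end w <= t < left_end w + m w.
Proof.
move=> t01; rewrite cylE mkseq_code.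
elim/last_ind: w => [|w b IH].
  by rewrite /left_end /= add0r m_nil.
rewrite size_rcons /=; have := m_rcons w; rewrite left_end_rcons.
have := m_ge0 (rcons w false); have := m_ge0 (rcons w true) => h1 h2 h3.
split=> [/rcons_inj[e]|].
  rewrite e => eb; move/IH: e => /andP[i1 i2]; case: b eb => [h|/negbT]; first by lra.
  rewrite -ltNge => h; lra.
case: b => h; have e : code_word t (size w) = w by apply/IH; lra.
  by rewrite e; congr rcons; lra.
by rewrite e; congr rcons; apply/negbTE; rewrite -ltNge; lra.
Qed.

Lemma measurable_code : measurable_fun setT code.
Proof.
apply: measurable_fun_cyl => w.
elim/last_ind: w => [|w b IH]; first by rewrite cyl_nil preimage_setT.
have -> : code @^-1` cyl (rcons w b) = code @^-1` cyl w `&`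
    [set t | (left_end w + m (rcons w false) <= t) = b].
  apply/seteqP; split=> t; rewrite /= !cylE !mkseq_code size_rcons /=.
    by move=> /rcons_inj[-> ->].
  by case=> -> ->.
apply: measurableI => //; set c := _ + _.
case: b.
  have -> : [set t | (c <= t) = true] = [set` `[c, +oo[%R].
    by apply/seteqP; split=> t /=; rewrite in_itv /= andbT.
  exact: measurable_itv.
have -> : [set t | (c <= t) = false] = [set` `]-oo, c[%R].
  by apply/seteqP; split=> t /=; rewrite in_itv /= ltNge; case: (c <= t).
exact: measurable_itv.
Qed.

(** The law of [code] under Lebesgue measure on [0, 1): nested half-open intervals of lengths [m w]
    code the cylinders, a concrete form of Kolmogorov's extension. *)
Lemma measure_of_weights :
  exists mu : probability Sigma R, forall w, mu (cyl w) = (m w)%:E.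
Proof.
pose X : {mfun measurableTypeR R >-> Sigma} :=
  HB.pack code (isMeasurableFun.Build _ _ _ _ code measurable_code).
exists (distribution (@unit_lebesgue R) X) => w.
have [l0 l1] := left_end_bounds w.
change (unit_lebesgue [set t | cyl w (code t)] = (m w)%:E).
rewrite (unit_lebesgue_itv l0 _ l1 (fun t h => @code_cylP t w h)) ?lerDl//.
by rewrite addrAC subrr add0r.
Qed.

End MeasureOfWeights.

(** * The potential *)

Section Lipschitz.
Variable R : realType.

Lemma lipschitz_cylP (f : Sigma -> R) (K : R) :
  (forall n x y, mkseq x n = mkseq y n -> `|f x - f y| <= K * 2 ^- n) ->
  forall x y, `|f x - f y| <= K * sdist R x y.
Proof.
move=> h x y; rewrite /sdist; case: pselect => [ex|nex]; last first.
  have -> : x = y.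
    by apply/funext => n; apply/eqP/negPn/negP => ne; apply: nex; exists n.
  by rewrite subrr normr0 mulr0.
case: ex_minnP => m mP mmin; apply: h; apply/mkseq_eqP => i im.
by apply/eqP/negPn/negP => /mmin; rewrite leqNgt im.
Qed.

Lemma lipschitz_continuous (f : Sigma -> R) : lipschitz_potential f -> continuous f.
Proof.
move=> [K hK] x; apply/cvgrPdist_lt => e e0.
have K1 : 0 < `|K| + 1 by rewrite ltr_wpDl.
have : 0 < e / (`|K| + 1) by rewrite divr_gt0.
have [n ne] : exists n : nat, (2 : R) ^- n < e / (`|K| + 1).
  have := @cvg_geometric R 1 (2^-1) _.
  rewrite ger0_norm ?invr_ge0// invf_lt1 ?ltr1n// => /(_ isT).
  move=> /cvgrPdist_lt /(_ (e / (`|K| + 1))); rewrite divr_gt0// => /(_ isT).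
  move=> [n _ /(_ n (leqnn n))] /=.
  rewrite sub0r normrN mul1r ger0_norm ?exprn_ge0 ?invr_ge0// exprVn => h.
  by exists n.
move=> _; apply: filterS (nbhs_cyl x n.+1) => y; rewrite cyl_mkseq => /esym.
move=> /(sdist_lt R) xy; apply: le_lt_trans (hK x y) _.
have s0 : 0 <= sdist R x y.
  by rewrite /sdist; case: pselect => // ex; rewrite invr_ge0 exprn_ge0.
apply: (@le_lt_trans _ _ ((`|K| + 1) * sdist R x y)).
  by apply: ler_wpM2r => //; have := ler_norm K; lra.
by rewrite mulrC -ltr_pdivlMr//; apply: lt_trans ne.
Qed.

Lemma compact_Sigma : compact [set: Sigma].
Proof. exact: cantor_space_compact. Qed.

Lemma continuous_bounded_measurable (f : Sigma -> R) : continuous f ->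
  bounded_measurable f.
Proof.
move=> cf; split; first exact: measurable_fun_continuous.
have cK : compact (f @` [set: Sigma]).
  by apply: continuous_compact; [apply: continuous_subspaceT|exact: compact_Sigma].
have [M [_ hM]] := compact_bounded cK.
exists (`|M| + 1) => x; apply: hM; last by exists x.
by have := ler_norm M; lra.
Qed.

End Lipschitz.

Section Potential.
Variables (R : realType) (c : bool -> nat -> R).

(* The price of the first run of [x] when [k] further symbols are prepended to it. *)
Definition run_cost k (x : Sigma) : R :=
  match pselect (exists n, x n.+1 != x 0%N) with
  | left ex => c (x 0%N) (k + (ex_minn ex).+1)
  | right _ => 0
  end.

Definition potential (x : Sigma) : R :=
  if x 0%N == x 1%N then 0 else - run_cost 0 (shift x).

Lemma run_cost_same k (x : Sigma) : x 1%N = x 0%N ->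
  run_cost k x = run_cost k.+1 (shift x).
Proof.
move=> x10; rewrite /run_cost; case: pselect => [ex|nex]; case: pselect => [ex'|nex'] //.
- case: ex_minnP => m mP mmin; case: ex_minnP => m' mP' mmin'.
  rewrite /shift x10 in mP' mmin' *.
  suff -> : m = m'.+1 by rewrite addnS addSn.
  apply/eqP; rewrite eqn_leq mmin//=; case: m mP mmin => [|m] mP mmin.
    by rewrite x10 eqxx in mP.
  by rewrite ltnS mmin'.
- case: nex'; case: ex => -[|n]; first by rewrite x10 eqxx.
  by move=> h; exists n; rewrite /shift x10.
- by case: nex; case: ex' => n; rewrite /shift x10 => h; exists n.+1.
Qed.

Lemma run_cost_diff k (x : Sigma) : x 1%N != x 0%N ->
  run_cost k x = c (x 0%N) k.+1.
Proof.
move=> x10; rewrite /run_cost; case: pselect => [ex|[]]; last by exists 0%N.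
case: ex_minnP => m mP /(_ 0%N x10); rewrite leqn0 => /eqP ->.
by rewrite addn1.
Qed.

Hypothesis c_gt0 : forall s n, 0 < c s n.
Hypothesis c_le : forall s n, c s n <= 2 ^- n.

Lemma exp2V_le (n m : nat) : (n <= m)%N -> (2 : R) ^- m <= 2 ^- n.
Proof. by move=> nm; rewrite lef_pV2 ?posrE ?exprn_gt0// ler_eXn2l ?ltr1n. Qed.

Lemma run_cost_ge0 k x : 0 <= run_cost k x.
Proof. by rewrite /run_cost; case: pselect => // ex; exact: ltW. Qed.

Lemma run_cost_le k x : run_cost k x <= 2 ^- k.+1.
Proof.
rewrite /run_cost; case: pselect => [ex|_]; last by rewrite invr_ge0 exprn_ge0.
by apply: le_trans (c_le _ _) _; apply: exp2V_le; rewrite addnS ltnS leq_addr.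
Qed.

(** Either the first run ends inside the common prefix and the two prices coincide, or it fills the
    prefix and both prices lie between 0 and the stated bound. *)
Lemma run_cost_agree j k x y : mkseq x j.+1 = mkseq y j.+1 ->
  `|run_cost k x - run_cost k y| <= 2 ^- (k + j.+1).
Proof.
elim: j k x y => [|j IH] k x y.
  move=> _; rewrite addn1 ler_norml.
  have := run_cost_ge0 k x; have := run_cost_le k x.
  have := run_cost_ge0 k y; have := run_cost_le k y; lra.
move=> /mkseq_shift_inj[e0 e]; have e1 : x 1%N = y 1%N.
  by exact: ((mkseq_eqP _ _ _).1 e 0%N isT).
have [x10|x10] := eqVneq (x 1%N) (x 0%N).
  have y10 : y 1%N = y 0%N by rewrite -e1 -e0.
  rewrite (run_cost_same k x10) (run_cost_same k y10).
  by apply: le_trans (IH _ _ _ e) _; rewrite addSnnS.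
have y10 : y 1%N != y 0%N by rewrite -e1 -e0.
rewrite (run_cost_diff k x10) (run_cost_diff k y10) -e0 subrr normr0.
by rewrite invr_ge0 exprn_ge0.
Qed.

Lemma potential_itv x : - 1 <= potential x <= 0.
Proof.
rewrite /potential; case: eqP => _; first by rewrite lexx lerN10.
have := run_cost_ge0 0 (shift x); have := run_cost_le 0 (shift x).
rewrite expr1; lra.
Qed.

Lemma potential_lipschitz : lipschitz_potential potential.
Proof.
(* For prefixes of length at most 1 it suffices that the potential has oscillation at most 1; for
   longer ones, passing to the shifted sequence loses a factor 2. The constant 4 covers both. *)
exists 4; apply: lipschitz_cylP => -[|[|j]] x y.
- move=> _; rewrite expr0 invr1 ler_norml.
  have := potential_itv x; have := potential_itv y; lra.
- move=> _; rewrite expr1 ler_norml.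
  have := potential_itv x; have := potential_itv y; lra.
move=> /mkseq_shift_inj[e0 e].
have e1 : x 1%N = y 1%N by exact: ((mkseq_eqP _ _ _).1 e 0%N isT).
rewrite /potential -e1 -e0; case: eqP => _.
  by rewrite subrr normr0 mulr_ge0// invr_ge0 exprn_ge0.
rewrite -opprD normrN; apply: le_trans (run_cost_agree 0 e) _.
rewrite add0n [2 ^+ j.+2]exprS invfM mulrA.
by rewrite ler_peMl ?invr_ge0 ?exprn_ge0//; lra.
Qed.

Lemma bounded_measurable_potential : bounded_measurable potential.
Proof.
apply: continuous_bounded_measurable; apply: lipschitz_continuous.
exact: potential_lipschitz.
Qed.

Lemma run_cost_eq0 (x : Sigma) : run_cost 0 x = 0 -> x = fun=> x 0%N.
Proof.
rewrite /run_cost; case: pselect => [ex /eqP|nex _]; first by rewrite gt_eqF.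
apply/funext => -[//|n]; apply/eqP/negPn/negP => ne; apply: nex.
by exists n.
Qed.

End Potential.

(** * Renewal weights *)

Section TailSums.
Variable R : realType.
Implicit Types (u : nat -> R) (K x : R).

Definition tail_sum u r : R := limn (series (fun i => u (r + i)%N)).

Variables (u : nat -> R) (K x : R).
Hypothesis x0 : 0 < x.
Hypothesis x1 : x < 1.
Hypothesis u_bound : forall n, 0 <= u n <= K * x ^+ n.

Let K_ge0 : 0 <= K.
Proof. by have /andP[a b] := u_bound 0; move: (le_trans a b); rewrite expr0 mulr1. Qed.

Let geom r : cvgn (series (geometric (K * x ^+ r) x)).
Proof. by apply: is_cvg_geometric_series; rewrite ger0_norm// ltW. Qed.

Let u_geom r n : u (r + n)%N <= geometric (K * x ^+ r) x n.
Proof. by rewrite /geometric /= -mulrA -exprD; case/andP: (u_bound (r + n)). Qed.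

Lemma is_cvg_tail_sum r : cvgn (series (fun i => u (r + i)%N)).
Proof.
apply: (@series_le_cvg R _ (geometric (K * x ^+ r) x)) => [n|n|n|]; last exact: geom.
- by case/andP: (u_bound (r + n)).
- by rewrite /geometric /= !mulr_ge0 ?exprn_ge0// ltW.
- exact: u_geom.
Qed.

Lemma tail_sum_ge0 r : 0 <= tail_sum u r.
Proof.
apply: limr_ge; first exact: is_cvg_tail_sum.
by near=> n; rewrite sumr_ge0// => i _; case/andP: (u_bound (r + i)).
Unshelve. all: by end_near. Qed.

Lemma tail_sumS r : tail_sum u r = u r + tail_sum u r.+1.
Proof.
have c1 := @is_cvg_tail_sum r.+1.
apply/cvg_lim => //; rewrite -(cvg_shiftS _ _).
have -> : [sequence series (fun i => u (r + i)%N) n.+1]_n =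
    (fun n => u r + series (fun i => u (r.+1 + i)%N) n).
  apply/funext => n; rewrite /= /series /= big_nat_recl//= addn0; congr (_ + _).
  by apply: eq_bigr => i _; rewrite addSnnS.
by apply: cvgD; [exact: cvg_cst|exact: c1].
Qed.

Lemma tail_sum_ge r : u r <= tail_sum u r.
Proof. by rewrite tail_sumS lerDl tail_sum_ge0. Qed.

(** The bound is again a constant times [x ^+ r], so tails of tails fall under the same
    hypotheses. *)
Lemma tail_sum_le r : tail_sum u r <= K / (1 - x) * x ^+ r.
Proof.
have -> : K / (1 - x) * x ^+ r = limn (series (geometric (K * x ^+ r) x)).
  rewrite mulrAC; apply/esym/cvg_lim => //; apply: cvg_geometric_series.
  by rewrite ger0_norm// ltW.
by apply: ler_lim; [exact: is_cvg_tail_sum|exact: geom|near=> n; apply: ler_sum => i _].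
Unshelve. all: by end_near. Qed.

End TailSums.

Section TupleSums.
Variable R : realType.

Lemma sum_tuple_cons n (F : seq bool -> R) :
  \sum_(w : n.+1.-tuple bool) F w =
  \sum_(b : bool) \sum_(w : n.-tuple bool) F (b :: w).
Proof.
rewrite pair_big /=.
rewrite (reindex (fun p : bool * n.-tuple bool => [tuple of p.1 :: p.2]))//=.
exists (fun w => (thead w, [tuple of behead w])) => [[b w] _|w _] /=.
  by congr pair; apply: val_inj.
by case/tupleP: w => b w; apply: val_inj.
Qed.

Lemma sum_tuple_nil (F : seq bool -> R) : \sum_(w : 0.-tuple bool) F w = F [::].
Proof.
rewrite (bigD1 [tuple])//= big1 ?addr0// => w /eqP[].
exact: tuple0.
Qed.

End TupleSums.

Section RenewalWeights.
Variables (R : realType) (c : bool -> nat -> R) (beta : R) (a : bool -> R).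
Hypothesis c_gt0 : forall s n, 0 < c s n.
Hypothesis c_le : forall s n, c s n <= 2 ^- n.
Hypothesis beta_ge0 : 0 <= beta.
Hypothesis a_gt0 : forall s, 0 < a s.

Definition run_weight s j : R := expR (- (beta * c s j) - a s * j%:R).
Definition run_tail s := tail_sum (run_weight s).
(** [run_tail2 s 1] is the sum of [j * run_weight s j]: a stationary measure sees a run of length
    [j] from each of its [j] positions. *)
Definition run_tail2 s := tail_sum (run_tail s).

Let x s := expR (- a s).
Let x_gt0 s : 0 < x s. Proof. exact: expR_gt0. Qed.
Let x_lt1 s : x s < 1. Proof. by rewrite expR_lt1 oppr_lt0. Qed.
Let X_gt0 s : 0 < 1 - x s. Proof. by rewrite subr_gt0. Qed.

Lemma cost_le1 s j : c s j <= 1.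
Proof.
by apply: le_trans (c_le s j) _; rewrite invf_le1 ?exprn_gt0// exprn_ege1// ler1n.
Qed.

Lemma run_weight_gt0 s j : 0 < run_weight s j.
Proof. exact: expR_gt0. Qed.

Lemma run_weight_bound s j : 0 <= run_weight s j <= 1 * x s ^+ j.
Proof.
rewrite ltW ?run_weight_gt0//= mul1r /x -expRM_natr ler_expR.
have := mulr_ge0 beta_ge0 (ltW (c_gt0 s j)); lra.
Qed.

Lemma run_tailS s r : run_tail s r = run_weight s r + run_tail s r.+1.
Proof. exact: (tail_sumS (x_gt0 s) (x_lt1 s) (run_weight_bound s)). Qed.

Lemma run_tail_ge s r : run_weight s r <= run_tail s r.
Proof. exact: (tail_sum_ge (x_gt0 s) (x_lt1 s) (run_weight_bound s)). Qed.

Lemma run_tail_gt0 s r : 0 < run_tail s r.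
Proof. exact: lt_le_trans (run_weight_gt0 s r) (run_tail_ge s r). Qed.

Lemma run_tail_bound s r : 0 <= run_tail s r <= (1 - x s)^-1 * x s ^+ r.
Proof.
rewrite ltW ?run_tail_gt0//= -[_^-1]mul1r.
exact: (tail_sum_le (x_gt0 s) (x_lt1 s) (run_weight_bound s)).
Qed.

Lemma run_tail2S s r : run_tail2 s r = run_tail s r + run_tail2 s r.+1.
Proof. exact: (tail_sumS (x_gt0 s) (x_lt1 s) (run_tail_bound s)). Qed.

Lemma run_tail2_gt0 s r : 0 < run_tail2 s r.
Proof.
apply: lt_le_trans (run_tail_gt0 s r) _.
exact: (tail_sum_ge (x_gt0 s) (x_lt1 s) (run_tail_bound s)).
Qed.

Lemma run_tail2_le s r : run_tail2 s r <= (1 - x s)^-1 / (1 - x s) * x s ^+ r.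
Proof. exact: (tail_sum_le (x_gt0 s) (x_lt1 s) (run_tail_bound s)). Qed.

(** [e s] stands for the total weight of all that may follow a completed run of [s]. Consistency,
    [e (~~ s) * run_tail (~~ s) 1 = e s] for both letters, forces the product of the two run totals
    to be 1; upper bounds use the corresponding inequality. *)
Variable e : bool -> R.
Hypothesis e_gt0 : forall s, 0 < e s.

(* Weight of the letters [w] that follow [r] letters [s] at the beginning of a run. *)
Fixpoint renewal_weight (w : seq bool) s r : R :=
  if w is b :: w' then
    if b == s then renewal_weight w' s r.+1
    else run_weight s r * renewal_weight w' b 1
  else e s * run_tail s r.

Lemma renewal_weight_gt0 w s r : 0 < renewal_weight w s r.
Proof.
elim: w s r => [|b w IH] s r /=; first by rewrite mulr_gt0 ?run_tail_gt0.
by case: ifP => _ //; rewrite mulr_gt0 ?run_weight_gt0.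
Qed.

Lemma renewal_weight_sum n s r :
  (forall s, e (~~ s) * run_tail (~~ s) 1 <= e s) ->
  \sum_(w : n.-tuple bool) renewal_weight w s r <= e s * run_tail s r.
Proof.
move=> he; elim: n s r => [|n IH] s r.
  by rewrite (sum_tuple_nil (fun w => renewal_weight w s r)).
have flip : \sum_(w : n.-tuple bool) run_weight s r * renewal_weight w (~~ s) 1 <=
    e s * run_weight s r.
  rewrite -mulr_sumr [X in _ <= X]mulrC ler_pM2l ?run_weight_gt0//.
  exact: le_trans (IH _ _) (he s).
rewrite (sum_tuple_cons n (fun w => renewal_weight w s r)) big_bool run_tailS mulrDr.
move: flip (IH s r.+1); case: s => /= h1 h2; last exact: lerD.
by rewrite addrC; exact: lerD.
Qed.

(* The logarithm of [run_weight s j] is the sum of [rate_potential] over a run, but for the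
   price of the run, which [potential] collects one letter before the run begins. *)
Definition rate_potential (y : Sigma) : R :=
  beta * potential c y - a (y 0%N).

Lemma birkhoffS (psi : Sigma -> R) n y :
  birkhoff psi n.+1 y = psi y + birkhoff psi n (shift y).
Proof.
rewrite /birkhoff big_ord_recl /=; congr (_ + _).
by apply: eq_bigr => i _; rewrite /= -iterSr.
Qed.

(** Up to a bounded error, the logarithm of the weight of the [n] letters after [y 0], when [r]
    letters of the same run precede [y 0]. The last two terms restore the price of that run,
    collected before it began, and the rates of those [r] letters. *)
Definition renewal_exponent n r (y : Sigma) : R :=
  birkhoff rate_potential n y - beta * run_cost c r y - a (y 0%N) * r%:R.

Lemma renewal_exponent_same n r y : y 1%N = y 0%N ->
  renewal_exponent n.+1 r y = renewal_exponent n r.+1 (shift y).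
Proof.
move=> y10; rewrite /renewal_exponent birkhoffS (run_cost_same _ _ y10).
rewrite /rate_potential /potential {1}y10 eqxx /shift y10 -natr1; lra.
Qed.

Lemma renewal_exponent_diff n r y : y 1%N != y 0%N ->
  expR (renewal_exponent n.+1 r y) =
  run_weight (y 0%N) r.+1 * expR (renewal_exponent n 0 (shift y)).
Proof.
move=> y10; rewrite /renewal_exponent birkhoffS (run_cost_diff _ _ y10).
rewrite /rate_potential /potential eq_sym (negbTE y10) /run_weight -expRD.
by congr expR; rewrite -natr1; lra.
Qed.

(** Both sides obey the same recursion in [n]. Only the unfinished last run differs: its price is
    between 0 and [beta], its tail between its first term and a geometric series, and [kmin] and
    [kmax] absorb this. *)
Lemma renewal_weight_exponent kmin kmax n r y :
  (forall s, kmin <= e s * expR (- beta - a s)) ->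
  (forall s, e s / (1 - x s) * expR beta <= kmax) ->
  kmin * expR (renewal_exponent n r y) <=
  renewal_weight (mkseq (shift y) n) (y 0%N) r.+1 <=
  kmax * expR (renewal_exponent n r y).
Proof.
move=> hmin hmax; elim: n r y => [|n IH] r y.
  have rc0 := run_cost_ge0 c_gt0 r y.
  have rc1 : run_cost c r y <= 1.
    apply: le_trans (run_cost_le c_le r y) _.
    by rewrite invf_le1 ?exprn_gt0// exprn_ege1// ler1n.
  have b0 := mulr_ge0 beta_ge0 rc0.
  have b1 : beta * run_cost c r y <= beta by rewrite ler_piMr.
  rewrite /= /renewal_exponent /birkhoff big_ord0; apply/andP; split.
    apply: le_trans (ler_wpM2l (ltW (e_gt0 _)) (run_tail_ge _ _)).
    apply: le_trans (ler_wpM2r (expR_ge0 _) (hmin (y 0%N))) _.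
    rewrite -mulrA ler_pM2l// -expRD ler_expR -natr1.
    have := ler_wpM2l beta_ge0 (cost_le1 (y 0%N) r.+1); lra.
  apply: le_trans (ler_wpM2r (expR_ge0 _) (hmax (y 0%N))).
  rewrite -!mulrA ler_pM2l//.
  have /andP[_ h] := run_tail_bound (y 0%N) r.+1.
  apply: le_trans h _; rewrite ler_pM2l ?invr_gt0// -expRD /x -expRM_natr ler_expR.
  have := a_gt0 (y 0%N).
  rewrite -natr1; lra.
rewrite mkseq_shift /= {1}/shift; case: eqP => [y10|/eqP y10].
  by rewrite (renewal_exponent_same _ _ y10) -y10; exact: IH r.+1 (shift y).
rewrite (renewal_exponent_diff _ _ y10) ![_ * (run_weight _ _ * _)]mulrCA.
by rewrite !ler_pM2l ?run_weight_gt0//; exact: IH.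
Qed.

Lemma renewal_weight_rcons w s r :
  (forall s, e (~~ s) * run_tail (~~ s) 1 = e s) ->
  renewal_weight (rcons w false) s r + renewal_weight (rcons w true) s r =
  renewal_weight w s r.
Proof.
move=> he; elim: w s r => [|b w IH] s r /=.
  rewrite [in RHS]run_tailS; have := he s; case: s => /= <-; ring.
by case: ifP => _; [exact: IH|rewrite -mulrDr IH].
Qed.

(** The square combines what follows the run through the origin with what precedes it: with two
    alternating letters, past and future satisfy the same equations, solved by the same [e]. *)
Definition stationary_norm : R :=
  (e true ^+ 2 * run_tail2 true 1 + e false ^+ 2 * run_tail2 false 1)^-1.

Lemma stationary_norm_gt0 : 0 < stationary_norm.
Proof. by rewrite invr_gt0 addr_gt0// mulr_gt0 ?exprn_gt0 ?run_tail2_gt0. Qed.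

(* Same as [renewal_weight], but the run of [s] may have begun arbitrarily far in the past. *)
Fixpoint stationary_run_weight (w : seq bool) s r : R :=
  if w is b :: w' then
    if b == s then stationary_run_weight w' s r.+1
    else stationary_norm * e s * run_tail s r * renewal_weight w' b 1
  else stationary_norm * e s ^+ 2 * run_tail2 s r.

Definition stationary_weight (w : seq bool) : R :=
  if w is b :: w' then stationary_run_weight w' b 1 else 1.

Lemma stationary_weight_gt0 w : 0 < stationary_weight w.
Proof.
case: w => //= b w; elim: w b 1%N => [|b' w IH] b r /=.
  by rewrite !mulr_gt0 ?stationary_norm_gt0 ?exprn_gt0 ?run_tail2_gt0.
case: ifP => _; first exact: IH.
by rewrite !mulr_gt0 ?stationary_norm_gt0 ?run_tail_gt0 ?renewal_weight_gt0.
Qed.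

(** The first run may have begun far in the past, so its price is dropped and its tails are compared
    with geometric series; from the first change of letter on, [renewal_weight_exponent] applies. *)
Lemma stationary_run_weight_le kmax n r y :
  (forall s, e s / (1 - x s) * expR beta <= kmax) ->
  stationary_run_weight (mkseq (shift y) n) (y 0%N) r.+1 <=
  (\sum_s stationary_norm * e s / (1 - x s) * (e s / (1 - x s) + kmax)) *
    expR (birkhoff rate_potential n y - a (y 0%N) * r%:R).
Proof.
move=> hmax; have Z0 := stationary_norm_gt0.
have kmax0 : 0 <= kmax.
  by apply: le_trans (hmax true); rewrite !mulr_ge0 ?expR_ge0 ?invr_ge0// ltW.
set KK := \sum_s _.
have P1 s : 0 <= stationary_norm * e s / (1 - x s) by rewrite ltW ?divr_gt0 ?mulr_gt0.
have P2 s : 0 <= e s / (1 - x s) by rewrite ltW ?divr_gt0.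
have KK_ge s : stationary_norm * e s / (1 - x s) * (e s / (1 - x s) + kmax) <= KK.
  rewrite /KK (bigD1 s)//= lerDl sumr_ge0// => s' _.
  by rewrite mulr_ge0// addr_ge0.
have KK1 s : stationary_norm * e s ^+ 2 * ((1 - x s)^-1 / (1 - x s)) <= KK.
  apply: le_trans (KK_ge s); rewrite mulrDr expr2.
  rewrite [X in _ <= X + _](_ : _ = stationary_norm * (e s * e s) *
    ((1 - x s)^-1 / (1 - x s))); last by ring.
  by rewrite lerDl mulr_ge0.
have KK2 s : stationary_norm * e s * (1 - x s)^-1 * kmax <= KK.
  apply: le_trans (KK_ge s); rewrite mulrDr lerDr.
  by rewrite mulr_ge0.
elim: n r y => [|n IH] r y.
  rewrite /= /birkhoff big_ord0 add0r.
  apply: le_trans (ler_wpM2r (expR_ge0 _) (KK1 (y 0%N))).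
  rewrite -[X in _ <= X]mulrA ler_pM2l ?mulr_gt0 ?exprn_gt0//.
  apply: le_trans (run_tail2_le _ _) _; rewrite ler_pM2l ?mulr_gt0 ?invr_gt0//.
  rewrite /x -expRM_natr ler_expR -natr1; have := a_gt0 (y 0%N); lra.
rewrite mkseq_shift /= {1}/shift birkhoffS; case: eqP => [y10|/eqP y10].
  rewrite -y10; apply: le_trans (IH r.+1 (shift y)) _.
  rewrite /rate_potential /potential y10 eqxx /shift y10 -natr1.
  by rewrite le_eqVlt; apply/orP; left; apply/eqP; congr (_ * expR _); lra.
have /andP[_ h1] := run_tail_bound (y 0%N) r.+1.
have /andP[_ h2] := renewal_weight_exponent n 0 (shift y) (kmin := 0)
   (fun s => mulr_ge0 (ltW (e_gt0 s)) (expR_ge0 _)) hmax.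
apply: le_trans (ler_wpM2r (expR_ge0 _) (KK2 (y 0%N))).
rewrite -!mulrA !ler_pM2l//.
apply: (@le_trans _ _ (((1 - x (y 0%N))^-1 * x (y 0%N) ^+ r.+1) *
    (kmax * expR (renewal_exponent n 0 (shift y))))).
  by apply: ler_pM => //; rewrite ltW ?run_tail_gt0 ?renewal_weight_gt0.
rewrite -!mulrA ler_pM2l ?invr_gt0// mulrCA ler_wpM2l//.
rewrite /x -expRM_natr -expRD ler_expR /renewal_exponent /rate_potential /potential.
rewrite eq_sym (negbTE y10) -natr1; lra.
Qed.

Section Stationary.
Hypothesis he : forall s, e (~~ s) * run_tail (~~ s) 1 = e s.

Lemma stationary_weight_rcons w :
  stationary_weight (rcons w false) + stationary_weight (rcons w true) =
  stationary_weight w.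
Proof.
case: w => [|b w] /=.
  have := stationary_norm_gt0; rewrite invr_gt0 => Z0.
  rewrite [LHS](_ : _ = stationary_norm * (e true ^+ 2 * run_tail2 true 1 +
    e false ^+ 2 * run_tail2 false 1)); last by ring.
  by rewrite mulVf// gt_eqF.
elim: w b 1%N => [|b' w IH] b r /=.
  by rewrite [in RHS]run_tail2S; have := he b; case: b => /= h; rewrite h; ring.
case: ifP => _; first exact: IH.
by rewrite -mulrDr renewal_weight_rcons.
Qed.

(** At [r = 1] the two terms are the two possible letters before the word: one prolongs its first
    run, the other makes that run begin at the word. This is shift invariance on cylinders. *)
Lemma stationary_run_weight_left w s r :
  stationary_run_weight w s r.+1 + stationary_norm * e s * renewal_weight w s r =
  stationary_run_weight w s r.
Proof.
elim: w r => [|b w IH] r /=; first by rewrite [in RHS]run_tail2S; ring.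
case: ifP => _; first exact: IH.
by rewrite [in RHS]run_tailS; ring.
Qed.

Lemma stationary_weight_cons w :
  stationary_weight (false :: w) + stationary_weight (true :: w) =
  stationary_weight w.
Proof.
case: w => [|b w]; first exact: (stationary_weight_rcons [::]).
rewrite -[RHS]stationary_run_weight_left -(he b).
by case: b => /=; ring.
Qed.

(** Additivity in the last letter produces the measure, additivity in the first letter makes it
    invariant. *)
Lemma stationary_measure : exists mu : probability Sigma R,
  invariant mu /\ forall w, mu (cyl w) = (stationary_weight w)%:E.
Proof.
have [mu hmu] := measure_of_weights (fun w => ltW (stationary_weight_gt0 w))
  erefl stationary_weight_rcons.
exists mu; split=> // A mA.
pose S : {mfun Sigma >-> Sigma} :=
  HB.pack (shift : Sigma -> Sigma) (isMeasurableFun.Build _ _ _ _ _ measurable_shift).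
apply: (@eq_probability_cyl R (distribution mu S) mu _ A mA) => w.
change (mu (shift @^-1` cyl w) = mu (cyl w)).
rewrite preimage_shift_cyl measureU.
- by rewrite hmu -stationary_weight_cons EFinD -!hmu.
- exact: measurable_cyl.
- exact: measurable_cyl.
- apply/seteqP; split=> // y; rewrite /cyl /= !mkseq_shift => -[[+ _] [+ _]].
  by move=> ->.
Qed.

End Stationary.

End RenewalWeights.

(** * Entropy bounds from the renewal weights *)

Section RenewalEntropy.
Variables (R : realType) (c : bool -> nat -> R) (beta : R) (a : bool -> R).
Hypothesis c_gt0 : forall s n, 0 < c s n.
Hypothesis c_le : forall s n, c s n <= 2 ^- n.
Hypothesis beta_ge0 : 0 <= beta.
Hypothesis a_gt0 : forall s, 0 < a s.

Local Notation psi := (rate_potential c beta a).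
Local Notation T := (run_tail c beta a).

Lemma measurable_label_head : measurable_label (fun y : Sigma => y 0%N).
Proof.
have -> : (fun y : Sigma => y 0%N) = (fun w : 1.-tuple bool => head false w) \o proj 1.
  by apply/funext => x; rewrite [RHS]/comp projE.
by apply: measurable_label_comp; exact: measurable_proj.
Qed.

Lemma preimage_head s : (fun y : Sigma => y 0%N) @^-1` [set s] = cyl [:: s].
Proof. by apply/seteqP; split=> y; rewrite /cyl /=; [move=> <-|case]. Qed.

Lemma bounded_measurable_rate_potential : bounded_measurable psi.
Proof.
apply: bounded_measurableD.
  by apply: bounded_measurableZ; exact: bounded_measurable_potential.
exact: (bounded_measurable_label (fun s => - a s) measurable_label_head).
Qed.

Lemma Rintegral_rate_potential (mu : probability Sigma R) :
  \int[mu]_x psi x = beta * \int[mu]_x potential c x -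
    (a true * fine (mu (cyl [:: true])) + a false * fine (mu (cyl [:: false]))).
Proof.
have bp := bounded_measurable_potential c_gt0 c_le.
rewrite RintegralD//; last 2 first.
- by apply: bounded_measurable_integrable; exact: bounded_measurableZ.
- apply: bounded_measurable_integrable.
  exact: (bounded_measurable_label (fun s => - a s) measurable_label_head).
rewrite RintegralZl//; last exact: bounded_measurable_integrable.
rewrite (Rintegral_label mu (fun s => - a s) measurable_label_head) big_bool.
by rewrite /= !preimage_head !mulNr -opprD.
Qed.

Lemma rate_potential_le0 y : psi y <= 0.
Proof.
have /andP[_ p0] := potential_itv c_gt0 c_le y.
have := mulr_ge0_le0 beta_ge0 p0; have := a_gt0 (y 0%N); rewrite /rate_potential; lra.
Qed.

Lemma rate_potential_ge y : - (beta + a true + a false) <= psi y.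
Proof.
have /andP[p1 _] := potential_itv c_gt0 c_le y.
have := ler_wpM2l beta_ge0 p1; have := a_gt0 true; have := a_gt0 false.
by rewrite /rate_potential mulrN1; case: (y 0%N); lra.
Qed.

Lemma birkhoffSr (f : Sigma -> R) n y :
  birkhoff f n.+1 y = birkhoff f n y + f (iter n shift y).
Proof. by rewrite /birkhoff big_ord_recr. Qed.

Section Weights.
Variable e : bool -> R.
Hypothesis e_gt0 : forall s, 0 < e s.

(** A word is weighted as if a run began at its first letter; forgetting the past changes the bounds
    by constants only. *)
Definition fresh_weight (w : seq bool) : R :=
  if w is b :: w' then renewal_weight c beta a e w' b 1 else 1.

Lemma fresh_weight_gt0 w : 0 < fresh_weight w.
Proof. by case: w => //= b w; exact: renewal_weight_gt0. Qed.

(** All large [C] are allowed because [entropy_of_weights] uses one constant both here and in the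
    bound on the measure of cylinders. *)
Lemma fresh_weight_bounds : (forall s, e (~~ s) * T (~~ s) 1 <= e s) ->
  exists C0 : R, forall C : R, C0 <= C ->
    (forall n, \sum_(w : n.-tuple bool) fresh_weight w <= C) /\
    (forall n x, birkhoff psi n x <= ln (fresh_weight (mkseq x n)) + C).
Proof.
move=> he.
pose k s := e s * expR (- beta - a s).
pose kmin := Num.min (k true) (k false).
have kmin0 : 0 < kmin by rewrite lt_min !mulr_gt0 ?expR_gt0.
have hmin s : kmin <= k s by rewrite ge_min; case: s; rewrite lexx ?orbT.
pose kk s := e s / (1 - expR (- a s)) * expR beta.
pose kmax := Num.max (kk true) (kk false).
have hmax s : kk s <= kmax by rewrite le_max; case: s; rewrite lexx ?orbT.
exists (1 + e true * T true 1 + e false * T false 1 + beta + `|ln kmin|) => C hC.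
have eT s : 0 < e s * T s 1 by rewrite mulr_gt0// run_tail_gt0.
have := eT true; have := eT false; have := normr_ge0 (ln kmin) => n0 eTf eTt.
have beta0 := beta_ge0.
split=> [[|n]|[|n] x].
- rewrite (sum_tuple_nil fresh_weight) /=; lra.
- rewrite (sum_tuple_cons n fresh_weight) big_bool /=.
  have := @renewal_weight_sum R c beta a c_gt0 beta_ge0 a_gt0 e n true 1 he.
  have := @renewal_weight_sum R c beta a c_gt0 beta_ge0 a_gt0 e n false 1 he.
  lra.
- rewrite /= ln1 /birkhoff big_ord0; lra.
have /andP[h _] := @renewal_weight_exponent R c beta a c_gt0 c_le beta_ge0 a_gt0 e
  e_gt0 kmin kmax n 0 x hmin hmax.
have rc0 := run_cost_ge0 c_gt0 0 x.
have rc1 : run_cost c 0 x <= 1.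
  apply: le_trans (run_cost_le c_le 0 x) _.
  by rewrite invf_le1 ?exprn_gt0// exprn_ege1// ler1n.
have brc : beta * run_cost c 0 x <= beta by rewrite ler_piMr.
have : ln kmin + renewal_exponent c beta a n 0 x <= ln (fresh_weight (mkseq x n.+1)).
  rewrite -[X in ln kmin + X]expRK -lnM ?posrE ?expR_gt0//.
  rewrite mkseq_shift ler_ln ?posrE ?mulr_gt0 ?expR_gt0//.
  exact: fresh_weight_gt0.
rewrite birkhoffSr /renewal_exponent mulr0 subr0.
have := rate_potential_le0 (iter n shift x).
have := ler_norm (- ln kmin); rewrite normrN.
lra.
Qed.

End Weights.

(** The two rates may differ: every admissible pair gives a linear inequality between the entropy,
    the integral of the potential and the letter masses of [mu]. *)
Lemma entropy_le_rate (mu : probability Sigma R) : invariant mu ->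
  T true 1 * T false 1 <= 1 -> (entropy mu <= (- \int[mu]_x psi x)%:E)%E.
Proof.
(* With this choice the condition on [e] is an equality at [true] and is exactly [TT] at [false]. *)
move=> imu TT; pose e s := if s then T false 1 else 1.
have T0 s : 0 < T s 1 by exact: run_tail_gt0.
have e0 s : 0 < e s by case: s => /=; rewrite ?T0.
have he s : e (~~ s) * T (~~ s) 1 <= e s.
  by case: s => /=; rewrite ?mul1r// mulrC.
have [C0 /(_ _ (lexx C0))[h1 h2]] := fresh_weight_bounds e0 he.
apply: (entropy_le_of_weights imu _ (fresh_weight_gt0 e0) h1 h2).
exact: bounded_measurable_rate_potential.
Qed.

Lemma entropy_eq_rate : a true = a false -> T true 1 * T false 1 = 1 ->
  exists2 mu : probability Sigma R, invariant mu &
    entropy mu = (- \int[mu]_x psi x)%:E.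
Proof.
move=> aa TT; pose e s := if s then T false 1 else 1.
have T0 s : 0 < T s 1 by exact: run_tail_gt0.
have e0 s : 0 < e s by case: s => /=; rewrite ?T0.
have he s : e (~~ s) * T (~~ s) 1 = e s.
  by case: s => /=; rewrite ?mul1r// mulrC.
have he' s : e (~~ s) * T (~~ s) 1 <= e s by rewrite he.
have [mu [imu hmu]] := @stationary_measure R c beta a c_gt0 beta_ge0 a_gt0 e e0 he.
exists mu => //; have beta0 := beta_ge0.
have [C0 hC0] := fresh_weight_bounds e0 he'.
pose kk s := e s / (1 - expR (- a s)) * expR beta.
pose kmax := Num.max (kk true) (kk false).
have hmax s : kk s <= kmax by rewrite le_max; case: s; rewrite lexx ?orbT.
have hst n y := @stationary_run_weight_le R c beta a c_gt0 c_le beta_ge0 a_gt0 e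
  e0 kmax n 0 y hmax.
move: hst; set KK := \sum_(s : bool) _ => hst.
pose C := `|C0| + KK + (beta + a true + a false).
have KK0 : 0 <= KK.
  have : 0 < KK * expR (birkhoff psi 0 zero_bar - a (zero_bar 0%N) * 0%:R).
    apply: lt_le_trans (hst 0%N zero_bar).
    exact: (stationary_weight_gt0 c_gt0 beta_ge0 a_gt0 e0 [:: false]).
  by rewrite pmulr_lgt0 ?expR_gt0// => /ltW.
have C0C : C0 <= C.
  by have := ler_norm C0; have := a_gt0 true; have := a_gt0 false; rewrite /C; lra.
have [h1 h2] := hC0 C C0C.
apply: (entropy_of_weights imu _ (fresh_weight_gt0 e0) h1 h2) => [|w|n x].
- exact: bounded_measurable_rate_potential.
- by rewrite hmu lte_fin; exact: stationary_weight_gt0.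
rewrite hmu lee_fin.
have C_ge0 : 0 <= C.
  by rewrite /C !addr_ge0// ltW.
case: n => [|n].
  rewrite /= /birkhoff big_ord0 add0r; apply: le_trans (expR_ge1Dx _).
  by rewrite lerDl.
rewrite mkseq_shift; apply: le_trans (hst n x) _.
rewrite mulr0 subr0 birkhoffSr.
apply: (@le_trans _ _ (expR KK * expR (birkhoff psi n x))).
  by apply: ler_wpM2r; rewrite ?expR_ge0//; have := expR_ge1Dx KK; lra.
rewrite -expRD ler_expR; have := rate_potential_ge (iter n shift x).
have := normr_ge0 C0; rewrite /C; lra.
Qed.

End RenewalEntropy.

(** * The pressure *)

Section TailSumOrder.
Variable R : realType.
Implicit Types (u v : nat -> R) (K x : R).

Lemma tail_sum_geometric K x r : 0 < x -> x < 1 ->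
  tail_sum (fun j => K * x ^+ j) r = K / (1 - x) * x ^+ r.
Proof.
move=> x0 x1; rewrite mulrAC; apply/cvg_lim => //.
have -> : (fun i => K * x ^+ (r + i)) = geometric (K * x ^+ r) x.
  by apply/funext => i; rewrite /geometric /= -mulrA -exprD.
by apply: cvg_geometric_series; rewrite ger0_norm// ltW.
Qed.

Lemma ler_tail_sum u v K x r : 0 < x -> x < 1 ->
  (forall n, 0 <= u n <= K * x ^+ n) -> (forall n, 0 <= v n <= K * x ^+ n) ->
  (forall n, (r <= n)%N -> u n <= v n) -> tail_sum u r <= tail_sum v r.
Proof.
move=> x0 x1 hu hv uv; apply: ler_lim.
- exact: is_cvg_tail_sum x0 x1 hu r.
- exact: is_cvg_tail_sum x0 x1 hv r.
by near=> n; apply: ler_sum => i _; rewrite uv// leq_addr.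
Unshelve. all: by end_near. Qed.

Lemma tail_sumB u v K x r : 0 < x -> x < 1 ->
  (forall n, 0 <= u n <= K * x ^+ n) -> (forall n, 0 <= v n <= K * x ^+ n) ->
  tail_sum u r - tail_sum v r = tail_sum (fun n => u n - v n) r.
Proof.
move=> x0 x1 hu hv; apply/esym/cvg_lim => //.
have -> : series (fun i => u (r + i)%N - v (r + i)%N) =
    (fun n => series (fun i => u (r + i)%N) n - series (fun i => v (r + i)%N) n).
  by apply/funext => n; rewrite /series /= sumrB.
by apply: cvgB; [exact: is_cvg_tail_sum x0 x1 hu r|exact: is_cvg_tail_sum x0 x1 hv r].
Qed.

Lemma tail_sum_le1 u K x r : 0 < x -> x < 1 ->
  (forall n, 0 <= u n <= K * x ^+ n) -> tail_sum u r.+1 <= tail_sum u 1.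
Proof.
move=> x0 x1 hu; elim: r => // r IH; apply: le_trans IH.
by rewrite [X in _ <= X](tail_sumS x0 x1 hu) lerDr; case/andP: (hu r.+1).
Qed.

End TailSumOrder.

Section Pressure.
Variables (R : realType) (c : bool -> nat -> R) (beta : R).
Hypothesis c_gt0 : forall s n, 0 < c s n.
Hypothesis c_le : forall s n, c s n <= 2 ^- n.
Hypothesis beta_ge0 : 0 <= beta.

Let coef s j : R := expR (- (beta * c s j)).
Let gen s (x : R) : R := tail_sum (fun j => coef s j * x ^+ j) 1.

Let coef_le1 s j : coef s j <= 1.
Proof. by rewrite -expR0 ler_expR oppr_le0 mulr_ge0// ltW. Qed.

Let gen_bound s x n : 0 < x -> 0 <= coef s n * x ^+ n <= 1 * x ^+ n.
Proof.
move=> x0; have xn : 0 <= x ^+ n by rewrite exprn_ge0// ltW.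
by rewrite mulr_ge0 ?expR_ge0//= ler_wpM2r.
Qed.

(* Since the coefficients lie in [0, 1], the increments are dominated by those of the
   geometric series. *)
Let gen_increment s x y : 0 < x -> x <= y -> y < 1 ->
  0 <= gen s y - gen s x <= y / (1 - y) - x / (1 - x).
Proof.
move=> x0 xy y1; have y0 := lt_le_trans x0 xy; have x1 := le_lt_trans xy y1.
have pw n : x ^+ n <= y ^+ n by apply: lerXn2r; rewrite // nnegrE ltW.
have hx n : 0 <= coef s n * x ^+ n <= 1 * y ^+ n.
  have /andP[-> h] := gen_bound s n x0; apply: le_trans h _.
  by rewrite !mul1r.
have hy n : 0 <= coef s n * y ^+ n <= 1 * y ^+ n by exact: gen_bound.
have gx n : 0 <= 1 * x ^+ n <= 1 * y ^+ n.
  by rewrite !mul1r exprn_ge0 ?pw// ltW.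
have gy n : 0 <= 1 * y ^+ n <= 1 * y ^+ n.
  by rewrite !mul1r lexx exprn_ge0// ltW.
have d1 n : 0 <= coef s n * y ^+ n - coef s n * x ^+ n <= 1 * y ^+ n.
  rewrite -mulrBr mulr_ge0 ?expR_ge0 ?subr_ge0//=.
  apply: ler_pM => //; rewrite ?expR_ge0 ?subr_ge0//.
  by rewrite lerBlDr lerDl exprn_ge0// ltW.
have d2 n : 0 <= 1 * y ^+ n - 1 * x ^+ n <= 1 * y ^+ n.
  by rewrite !mul1r subr_ge0 pw/= lerBlDr lerDl exprn_ge0// ltW.
rewrite /gen (tail_sumB 1 y0 y1 hy hx); apply/andP; split.
  exact: tail_sum_ge0 y0 y1 d1 1%N.
have -> : y / (1 - y) - x / (1 - x) =
    tail_sum (fun n => 1 * y ^+ n - 1 * x ^+ n) 1.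
  rewrite -(tail_sumB 1 y0 y1 gy gx) !tail_sum_geometric//.
  by rewrite !mul1r !expr1 ![_^-1 * _]mulrC.
apply: (ler_tail_sum y0 y1 d1 d2) => n _.
by rewrite -!mulrBr ler_wpM2r// subr_ge0.
Qed.

(** Up to [q] the slope of x / (1 - x) is at most (1 - q)^-2, and [gen_increment] passes this
    Lipschitz bound on to [gen s]. *)
Let gen_continuous s (p q : R) : 0 < p -> q < 1 ->
  {within `[p, q], continuous (gen s)}.
Proof.
move=> p0 q1; apply/subspace_continuousP => x /=; rewrite in_itv /= => /andP[px xq].
apply/cvgrPdist_lt => e e0.
have q1' : 0 < (1 - q) ^+ 2 by rewrite exprn_gt0// subr_gt0.
have inc u v : p <= u -> u <= v -> v <= q ->
    `|gen s v - gen s u| <= (v - u) / (1 - q) ^+ 2.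
  move=> pu uv vq; have u0 := lt_le_trans p0 pu; have v1 := le_lt_trans vq q1.
  have /andP[h1 h2] := gen_increment s u0 uv v1.
  rewrite ger0_norm//; apply: le_trans h2 _.
  have -> : v / (1 - v) - u / (1 - u) = (v - u) / ((1 - v) * (1 - u)).
    by field; rewrite !gt_eqF//; lra.
  apply: ler_wpM2l; first by rewrite subr_ge0.
  rewrite lef_pV2 ?posrE//; last by rewrite mulr_gt0//; lra.
  by rewrite expr2; apply: ler_pM; lra.
rewrite near_withinE; near=> y => /=; rewrite in_itv /= => /andP[py yq].
have yx : `|x - y| < e * (1 - q) ^+ 2.
  by near: y; apply: cvgr_dist_lt => //; rewrite mulr_gt0.
rewrite -ltr_pdivrMr// in yx; apply: le_lt_trans yx.
have [xy|/ltW yx] := leP x y.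
  rewrite distrC (distrC x) [`|y - x|]ger0_norm ?subr_ge0//; exact: inc.
rewrite [`|x - y|]ger0_norm ?subr_ge0//; exact: inc.
Unshelve. all: by end_near. Qed.

Lemma run_tail_constE P s r : run_tail c beta (fun=> P) s r =
  tail_sum (fun j => coef s j * expR (- P) ^+ j) r.
Proof.
congr tail_sum; apply/funext => j.
by rewrite /run_weight expRD -expRM_natr mulNr.
Qed.

Lemma pressure_root : exists2 P : R, 0 < P &
  run_tail c beta (fun=> P) true 1 * run_tail c beta (fun=> P) false 1 = 1.
Proof.
(* The intermediate value theorem is applied in x = exp (- P). At 1/2 each series is at most the
   geometric one, which equals 1; the coefficients being at least exp (- beta) and q / (1 - q) being
   exp beta, each series is at least 1 at [q]. *)
pose q := expR beta / (1 + expR beta).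
have E1 : 1 <= expR beta by rewrite -expR0 ler_expR.
have E0 : 0 < 1 + expR beta by lra.
have q1 : q < 1 by rewrite ltr_pdivrMr//; lra.
have q2 : 2^-1 <= q by rewrite ler_pdivlMr//; lra.
have q0 : 0 < q by lra.
have half1 : (2^-1 : R) < 1 by lra.
have half0 : 0 < (2^-1 : R) by lra.
pose Phi x := gen true x * gen false x.
have cPhi : {within `[2^-1, q], continuous Phi}.
  by move=> x; apply: cvgM; [exact: gen_continuous|exact: gen_continuous].
have gen_half s : 0 <= gen s 2^-1 <= 1.
  apply/andP; split.
    exact: (tail_sum_ge0 half0 half1 (fun n => gen_bound s n half0)).
  apply: le_trans (tail_sum_le half0 half1 (fun n => gen_bound s n half0) 1) _.
  by rewrite expr1 (_ : 1 - 2^-1 = 2^-1); [rewrite divfK|lra].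
have gen_q s : 1 <= gen s q.
  have : tail_sum (fun j => expR (- beta) * q ^+ j) 1 <= gen s q.
    have hq n : 0 <= expR (- beta) * q ^+ n <= 1 * q ^+ n.
      have qn : 0 <= q ^+ n by rewrite exprn_ge0// ltW.
      rewrite mulr_ge0 ?expR_ge0//= ler_wpM2r//.
      by rewrite -expR0 ler_expR oppr_le0.
    apply: (ler_tail_sum q0 q1 hq (fun n => gen_bound s n q0)) => n _.
    rewrite ler_wpM2r ?exprn_ge0 ?(ltW q0)// ler_expR lerN2.
    by rewrite ler_piMr//; exact: cost_le1 c_le s n.
  apply: le_trans; rewrite tail_sum_geometric// expr1.
  have -> : 1 - q = (1 + expR beta)^-1 by rewrite /q; field; rewrite gt_eqF.
  rewrite invrK expRN /q le_eqVlt; apply/orP; left; apply/eqP.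
  by field; rewrite !gt_eqF// expR_gt0.
have := @IVT R Phi 2^-1 q 1 q2 cPhi.
have /andP[a0 a1] := gen_half true; have /andP[b0 b1] := gen_half false.
have := gen_q true; have := gen_q false => c1 d1.
have P1 : Phi 2^-1 <= 1 by exact: mulr_ile1.
have P2 : 1 <= Phi q by exact: mulr_ege1.
rewrite ge_min P1 le_max P2 orbT => /(_ isT)[x].
rewrite in_itv /= => /andP[x1 x2] Px.
have x0 : 0 < x by lra.
exists (- ln x); first by rewrite oppr_gt0 ln_lt0// x0; lra.
by rewrite !run_tail_constE opprK lnK.
Qed.

End Pressure.

(** * Gibbs measures *)

Section Gibbs.
Variables (R : realType) (c : bool -> nat -> R) (beta : R).
Hypothesis c_gt0 : forall s n, 0 < c s n.
Hypothesis c_le : forall s n, c s n <= 2 ^- n.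
Hypothesis beta_ge0 : 0 <= beta.

Local Notation phi := (potential c).
Local Notation T := (run_tail c beta).

Lemma probability_head (mu : probability Sigma R) :
  fine (mu (cyl [:: true])) + fine (mu (cyl [:: false])) = 1.
Proof.
by rewrite -(sum_label_probability mu measurable_label_head) big_bool !preimage_head.
Qed.

Lemma free_energyE (mu : probability Sigma R) :
  free_energy (fun x => beta * phi x) mu =
  (entropy mu + (beta * \int[mu]_x phi x)%:E)%E.
Proof.
have bp := bounded_measurable_potential c_gt0 c_le.
rewrite /free_energy EFin_Rintegral; last exact: bounded_measurableZ.
by rewrite RintegralZl//; exact: bounded_measurable_integrable.
Qed.

Lemma gibbs_entropy : exists P : R,
  [/\ 0 < P, T (fun=> P) true 1 * T (fun=> P) false 1 = 1,
      invariant (gibbs (fun x => beta * phi x)) &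
      entropy (gibbs (fun x => beta * phi x)) =
      (P - beta * \int[gibbs (fun x => beta * phi x)]_x phi x)%:E].
Proof.
have [P P0 PT] := pressure_root c_gt0 c_le beta_ge0.
exists P.
have rate (mu : probability Sigma R) :
    - (\int[mu]_x rate_potential c beta (fun=> P) x) = P - beta * \int[mu]_x phi x.
  rewrite (Rintegral_rate_potential _ _ c_gt0 c_le) -mulrDr probability_head; lra.
have sup_le mu : invariant mu -> (free_energy (fun x => (beta * phi x)%R) mu <= P%:E)%E.
  move=> imu; rewrite free_energyE.
  have := @entropy_le_rate R c beta (fun=> P) c_gt0 c_le beta_ge0 (fun=> P0) mu imu.
  rewrite PT lexx rate => /(_ isT) h; apply: le_trans (leeD2r _ h) _.
  by rewrite -EFinD subrK.
have [mu imu emu] := @entropy_eq_rate R c beta (fun=> P) c_gt0 c_le beta_ge0 (fun=> P0) erefl PT.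
have fmu : free_energy (fun x => beta * phi x) mu = P%:E.
  by rewrite free_energyE emu rate -EFinD subrK.
have supE : ereal_sup [set free_energy (fun x => beta * phi x) nu |
    nu in invariant (R := R)] = P%:E.
  apply/eqP; rewrite eq_le; apply/andP; split.
    by apply: ge_ereal_sup => _ [nu inu <-]; exact: sup_le.
  by apply: ereal_sup_ubound; exists mu.
have [|inu] := @getPex _ (equilibrium (fun x => beta * phi x)).
  by exists mu; split=> //; rewrite supE.
rewrite -/(gibbs (fun x => beta * phi x)) supE free_energyE => hnu.
split=> //; move: hnu; case: (entropy _) => [h| |]//= [<-].
by rewrite addrK.
Qed.

(** Comparing the exact entropy with the bound for the rates [a], the integral of the potential
    cancels and only the letter masses remain. *)
Lemma gibbs_pressure_le (a : bool -> R) (P : R) : (forall s, 0 < a s) ->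
  invariant (gibbs (fun x => beta * phi x)) ->
  entropy (gibbs (fun x => beta * phi x)) =
      (P - beta * \int[gibbs (fun x => beta * phi x)]_x phi x)%:E ->
  T a true 1 * T a false 1 <= 1 ->
  P <= a true * fine (gibbs (fun x => beta * phi x) (cyl [:: true])) +
       a false * fine (gibbs (fun x => beta * phi x) (cyl [:: false])).
Proof.
move=> a0 inu hnu TT; have := entropy_le_rate c_gt0 c_le beta_ge0 a0 inu TT.
rewrite hnu lee_fin (Rintegral_rate_potential _ _ c_gt0 c_le); lra.
Qed.

End Gibbs.

(** * Concentration on the letter with the long runs *)

Section Concentration.
Variables (R : realType) (c : bool -> nat -> R) (beta : R).
Hypothesis c_gt0 : forall s n, 0 < c s n.
Hypothesis c_le : forall s n, c s n <= 2 ^- n.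
Hypothesis beta_ge0 : 0 <= beta.
Variables (b : bool) (N M : nat) (eta : R).
Hypothesis eta_gt0 : 0 < eta.
Hypothesis eta_le1 : eta <= 1.
Hypothesis MN : M.+2%:R <= eta * N%:R / 2.
Hypothesis N_large : 8 / eta * expR (1 + 8 / eta) <= N%:R.
Hypothesis cost_high : forall j, (j <= N)%N -> N%:R <= beta * c b j.
Hypothesis cost_low : forall j, (N < j)%N -> beta * c b j <= 1.
Hypothesis cost_low' : forall j, (M < j)%N -> beta * c (~~ b) j <= 1.

Local Notation T := (run_tail c beta).

Let geometric_le (y : R) : 0 < y -> expR (- y) / (1 - expR (- y)) <= y^-1.
Proof.
move=> y0; have h : expR (- y) < 1 by rewrite expR_lt1 oppr_lt0.
rewrite ler_pdivrMr ?subr_gt0// mulrC ler_pdivlMr//.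
have := expR_ge1Dx y; have e0 := expR_gt0 (- y) => h1.
have : expR (- y) * (1 + y) <= expR (- y) * expR y by rewrite ler_pM2l.
rewrite -expRD addNr expR0; lra.
Qed.

Let tail_low (P : R) s r : 0 < P -> (forall j, (r < j)%N -> beta * c s j <= 1) ->
  expR (- 1) * (expR (- P) ^+ r.+1 / (1 - expR (- P))) <= T (fun=> P) s 1.
Proof.
move=> P0 low; have x0 := expR_gt0 (- P).
have x1 : expR (- P) < 1 by rewrite expR_lt1 oppr_lt0.
have hb := @run_weight_bound R c beta (fun=> P) c_gt0 beta_ge0 s.
apply: le_trans (tail_sum_le1 r x0 x1 hb).
have -> : expR (- 1) * (expR (- P) ^+ r.+1 / (1 - expR (- P))) =
    tail_sum (fun j => expR (- 1) * expR (- P) ^+ j) r.+1.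
  by rewrite tail_sum_geometric// mulrA mulrAC.
apply: (ler_tail_sum x0 x1 _ hb) => n.
  rewrite mulr_ge0 ?expR_ge0 ?exprn_ge0//= ler_wpM2r ?exprn_ge0 ?expR_ge0//.
move=> rn; rewrite /run_weight expRD -[- (P * _)]mulNr expRM_natr ler_wpM2r ?exprn_ge0 ?expR_ge0//.
by rewrite ler_expR lerN2 low.
Qed.

Let head_le (a : bool -> R) : (forall s, 0 < a s) -> forall r, (r <= N)%N ->
  T a b 1 <= r%:R * expR (- N%:R) + T a b r.+1.
Proof.
move=> a0; elim=> [|r IH] rN; first by rewrite mul0r add0r.
apply: le_trans (IH (ltnW rN)) _.
rewrite (run_tailS c_gt0 beta_ge0 a0 b r.+1) addrA lerD2r -natr1 mulrDl mul1r lerD2l.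
rewrite /run_weight ler_expR; have := cost_high rN.
have := mulr_ge0 (ltW (a0 b)) (ler0n R r.+1); lra.
Qed.

(** Keeping only the long, cheap runs in the equation for [P] gives the first bound. With K = 8 /
    eta, if P N < K, then M + 2 <= N turns it into exp (- 2 K) < exp 2 * (K / N)^2, that is N < K
    exp (1 + K), against [N_large]. *)
Let pressure_large (P : R) : 0 < P -> T (fun=> P) true 1 * T (fun=> P) false 1 = 1 ->
  expR (- (P * (N + M).+2%:R)) <= expR 2 * P ^+ 2 /\ 8 / eta <= P * N%:R.
Proof.
move=> P0 TT; have Tb : T (fun=> P) b 1 * T (fun=> P) (~~ b) 1 = 1.
  by case: b => //=; rewrite mulrC.
have x0 := expR_gt0 (- P).
have x1 : expR (- P) < 1 by rewrite expR_lt1 oppr_lt0.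
have h1 := tail_low P0 cost_low; have h2 := tail_low P0 cost_low'.
have xP : 1 - expR (- P) <= P by have := expR_ge1Dx (- P); lra.
have X0 : 0 < 1 - expR (- P) by rewrite subr_gt0.
have A : expR (- (P * (N + M).+2%:R)) <= expR 2 * P ^+ 2.
  have : (expR (- 1) * (expR (- P) ^+ N.+1 / (1 - expR (- P)))) *
      (expR (- 1) * (expR (- P) ^+ M.+1 / (1 - expR (- P)))) <= 1.
    apply: (@le_trans _ _ (T (fun=> P) b 1 * T (fun=> P) (~~ b) 1)); last by rewrite Tb.
    apply: ler_pM => //.
      by rewrite !mulr_ge0 ?exprn_ge0 ?expR_ge0 ?invr_ge0// ltW.
    by rewrite !mulr_ge0 ?exprn_ge0 ?expR_ge0 ?invr_ge0// ltW.
  have -> : (expR (- 1) * (expR (- P) ^+ N.+1 / (1 - expR (- P)))) *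
      (expR (- 1) * (expR (- P) ^+ M.+1 / (1 - expR (- P)))) =
      (expR (-1) * expR (-1)) * (expR (- P) ^+ (N.+1 + M.+1)) / (1 - expR (- P)) ^+ 2.
    by rewrite exprD; field; rewrite gt_eqF.
  rewrite ler_pdivrMr ?exprn_gt0// mul1r -expRM_natr -!expRD => h.
  rewrite -[X in X <= _]mul1r -{1}expR0 -(subrr 2) expRD -mulrA ler_pM2l ?expR_gt0//.
  have -> : (N + M).+2 = (N.+1 + M.+1)%N by rewrite addSn addnS.
  rewrite -expRD; apply: le_trans (_ : (1 - expR (- P)) ^+ 2 <= _).
    by apply: le_trans h; rewrite ler_expR; lra.
  by apply: lerXn2r; rewrite // nnegrE ltW.
split=> //; set K := 8 / eta; rewrite leNgt; apply/negP => PK.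
have K0 : 0 < K by rewrite divr_gt0.
have N0 : 0 < N%:R :> R.
  by apply: lt_le_trans N_large; rewrite mulr_gt0 ?expR_gt0.
have MN' : M.+2%:R <= N%:R :> R.
  apply: le_trans MN _.
  have := ler_wpM2r (ltW N0) eta_le1; lra.
have B : expR (- (2 * K)) < expR (- (P * (N + M).+2%:R)).
  rewrite ltr_expR ltrN2 -!addnS natrD mulrDr.
  have := ler_wpM2l (ltW P0) MN'; lra.
have := lt_le_trans B A => {A B}.
have : P ^+ 2 < (K / N%:R) ^+ 2.
  by apply: ltrXn2r; rewrite // ?nnegrE ?ltW// ?divr_gt0// ltr_pdivlMr.
rewrite -(ltr_pM2l (expR_gt0 2)) => h1' /lt_trans/(_ h1').
rewrite ltNge => /negP; apply.
have h3 : (K * expR (1 + K)) ^+ 2 <= N%:R ^+ 2.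
  apply: lerXn2r; rewrite ?nnegrE ?(ltW N0)//.
  by rewrite mulr_ge0 ?expR_ge0 ?ltW.
rewrite exprMn in h3.
rewrite expr_div_n mulrA ler_pdivrMr ?exprn_gt0//.
rewrite -(ler_pM2l (expR_gt0 (- (2 * K)))) in h3.
rewrite (_ : expR (- (2 * K)) * (K ^+ 2 * expR (1 + K) ^+ 2) = expR 2 * K ^+ 2) in h3.
  exact: h3.
rewrite -expRM_natl [LHS]mulrCA -expRD [LHS]mulrC; congr (expR _ * _); lra.
Qed.

Lemma gibbs_concentration :
  invariant (gibbs (fun x => beta * potential c x)) /\
  fine (gibbs (fun x => beta * potential c x) (cyl [:: ~~ b])) <= 2 * eta.
Proof.
have [P [P0 PT inu hnu]] := gibbs_entropy c_gt0 c_le beta_ge0.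
split=> //.
have [hA hPN] := pressure_large P0 PT.
have eta0 := eta_gt0.
(* The margin [eta] on [b] pays for almost halving the other rate; it remains to check that the
   product of the run totals is at most 1, in two halves [S1] and [S2]. *)
pose a s := if s == b then (1 + eta) * P else (2^-1 + eta) * P.
have a0 s : 0 < a s by rewrite /a; case: eqP => _; rewrite mulr_gt0//; lra.
have N0 : 0 < N%:R :> R.
  by apply: lt_le_trans N_large; rewrite mulr_gt0 ?expR_gt0// divr_gt0.
have ab : a b = (1 + eta) * P by rewrite /a eqxx.
have anb : a (~~ b) = (2^-1 + eta) * P by rewrite /a; case: b.
have T1 : T a b 1 <= N%:R * expR (- N%:R) + expR (- (N%:R * a b)) / P.
  apply: le_trans (head_le a0 (leqnn N)) _; rewrite lerD2l.
  have /andP[_ h] := run_tail_bound c_gt0 beta_ge0 a0 b N.+1.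
  apply: le_trans h _; rewrite exprSr mulrCA -expRM_natl mulrN ler_wpM2l ?expR_ge0//.
  rewrite mulrC; apply: le_trans (geometric_le (a0 b)) _.
  rewrite lef_pV2 ?posrE// ab; have := mulr_gt0 eta0 P0; lra.
have T2 : T a (~~ b) 1 <= 2 / P.
  have /andP[_ h] := run_tail_bound c_gt0 beta_ge0 a0 (~~ b) 1.
  apply: le_trans h _; rewrite expr1 mulrC.
  apply: le_trans (geometric_le (a0 (~~ b))) _.
  rewrite -[2]invrK -invfM lef_pV2 ?posrE ?mulr_gt0 ?invr_gt0// anb.
  have := mulr_gt0 eta0 P0; lra.
(* Short runs of [b]: as P N >= 8, the product is at most N^2 exp (- N) / 4, and exp N >= N^2 /
   2. *)
have S1 : N%:R * expR (- N%:R) * (2 / P) <= 2^-1.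
  have PN8 : 8 <= P * N%:R.
    by apply: le_trans hPN; rewrite ler_pdivlMr//; have := eta_le1; lra.
  have := expR_ge1Dxn 1 (ltW N0); rewrite (_ : 2`! = 2%N)// => h.
  have E0 := expR_gt0 (- N%:R : R).
  have : expR (- N%:R) * (1 + N%:R ^+ 2 / 2) <= expR (- N%:R) * expR N%:R :> R.
    by rewrite ler_pM2l.
  rewrite -expRD addNr expR0 => h'.
  rewrite mulrA ler_pdivrMr// -(ler_pM2l N0).
  set E := expR _ in E0 h' *.
  rewrite expr2 in h'; lra.
(* Long runs of [b]: [hA] absorbs exp (- P (N + M + 2)) into exp 2 * P^2. By [MN] the rest is at
   most exp (- eta P N / 2), hence at most exp (- 4) since P N >= 8 / eta; finally exp (- 2) <=
   1/4. *)
have S2 : expR (- (N%:R * a b)) / P * (2 / P) <= 2^-1.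
  have e4 : 4 <= expR 2 :> R.
    have := expR_ge1Dx (1 : R); rewrite (_ : (2 : R) = 1 + 1)// expRD => e1.
    have : 2 * 2 <= expR 1 * expR 1 :> R by apply: ler_pM; lra.
    lra.
  have E1 : expR (- (N%:R * a b)) <= expR 2 * P ^+ 2 * expR (- 4).
    apply: le_trans (ler_wpM2r (expR_ge0 _) hA); rewrite -expRD ler_expR ab.
    rewrite ler_pdivrMr// in hPN.
    have := ler_wpM2l (ltW P0) MN; rewrite -!addnS natrD; lra.
  have E2 : expR (- 4) = (expR 2)^-1 * (expR 2)^-1 :> R.
    by rewrite -!expRN -expRD; congr expR; lra.
  have E3 : expR (- (N%:R * a b)) <= P ^+ 2 / expR 2.
    apply: le_trans E1 _; rewrite E2 le_eqVlt; apply/orP; left; apply/eqP.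
    by field; rewrite gt_eqF ?expR_gt0.
  have E4 : expR (- (N%:R * a b)) <= P ^+ 2 / 4.
    apply: le_trans E3 _; rewrite ler_wpM2l ?exprn_ge0 ?(ltW P0)//.
    by rewrite lef_pV2 ?posrE ?expR_gt0.
  rewrite mulrACA -invfM -expr2 ler_pdivrMr ?exprn_gt0//; lra.
have TT : T a true 1 * T a false 1 <= 1.
  have -> : T a true 1 * T a false 1 = T a b 1 * T a (~~ b) 1.
    by case: b => //=; rewrite mulrC.
  have Tg0 s := ltW (run_tail_gt0 c_gt0 beta_ge0 a0 s 1).
  apply: le_trans (ler_pM (Tg0 _) (Tg0 _) T1 T2) _; rewrite mulrDl.
  by apply: le_trans (lerD S1 S2) _; lra.
have := gibbs_pressure_le c_gt0 c_le beta_ge0 a0 inu hnu TT.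
set nu := gibbs _; have := probability_head nu.
have -> : fine (nu (cyl [:: true])) + fine (nu (cyl [:: false])) =
   fine (nu (cyl [:: b])) + fine (nu (cyl [:: ~~ b])).
  by case: b => //=; rewrite addrC.
have -> : a true * fine (nu (cyl [:: true])) + a false * fine (nu (cyl [:: false])) =
   a b * fine (nu (cyl [:: b])) + a (~~ b) * fine (nu (cyl [:: ~~ b])).
  by case: b => //=; rewrite addrC.
rewrite ab anb; set u := fine _; set v := fine _ => uv.
have -> : u = 1 - v by lra.
move=> h; rewrite -(ler_pM2l P0); lra.
Qed.

End Concentration.

(** * Oscillation of the cost *)

Section FactorialCost.
Variable R : realType.

Lemma threshold_exists (s : bool) n : exists i, (odd i == s) && (n <= i`!)%N.
Proof.
exists (n.*2 + s)%N; rewrite oddD odd_double addFb oddb eqxx /=.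
by apply: leq_trans (fact_geq _); rewrite -addnn -addnA leq_addr.
Qed.

Definition threshold s n : nat := ex_minn (threshold_exists s n).

Definition fact_cost (s : bool) (n : nat) : R := 2 ^- (threshold s n)`!.

Lemma fact_cost_gt0 s n : 0 < fact_cost s n.
Proof. by rewrite invr_gt0 exprn_gt0. Qed.

Lemma fact_cost_le s n : fact_cost s n <= 2 ^- n.
Proof.
by rewrite /fact_cost /threshold; case: ex_minnP => i /andP[_ ni] _; exact: exp2V_le.
Qed.

(* At this inverse temperature the runs of [odd k] of length at most [k!] are priced out,
   whereas those of the other symbol are free beyond length [(k - 1)!]. *)
Definition fact_beta k : R := k`!%:R * 2 ^+ k`!.

Lemma fact_beta_ge k : k%:R <= fact_beta k.
Proof.
apply: (@le_trans _ _ k`!%:R); first by rewrite ler_nat fact_geq.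
by rewrite /fact_beta ler_peMr// exprn_ege1// ler1n.
Qed.

(** The factor k! in [fact_beta] is below 2^(k!), so [fact_beta k] is at most 2^(2 k!), and 2 k! <=
    (k + 1)! bounds this by the inverse price at the next threshold. *)
Lemma fact_beta_cost_low k s n : (k < threshold s n)%N -> (0 < k)%N ->
  fact_beta k * fact_cost s n <= 1.
Proof.
move=> kt k0; rewrite /fact_cost ler_pdivrMr ?exprn_gt0// mul1r.
apply: (@le_trans _ _ (2 ^+ (k`! + k`!))).
  rewrite /fact_beta exprD ler_wpM2r ?exprn_ge0// -natrX ler_nat.
  exact/ltnW/ltn_expl.
rewrite ler_eXn2l ?ltr1n//.
have k1t : (k.+1`! <= (threshold s n)`!)%N by apply: leq_fact.
by apply: leq_trans k1t; rewrite factS addnn -mul2n leq_mul2r ltnS k0 orbT.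
Qed.

Lemma fact_beta_cost_high k n : (n <= k`!)%N ->
  k`!%:R <= fact_beta k * fact_cost (odd k) n.
Proof.
move=> nk; rewrite /fact_cost ler_pdivlMr ?exprn_gt0// /fact_beta.
rewrite ler_wpM2l// ler_eXn2l ?ltr1n// /threshold.
case: ex_minnP => i _ /(_ k); rewrite eqxx nk => /(_ isT) ik.
exact: leq_fact.
Qed.

Lemma fact_gibbs_concentration (eta : R) : 0 < eta -> eta <= 1 ->
  exists k0, forall k, (k0 <= k)%N ->
    invariant (gibbs (fun x => fact_beta k * potential fact_cost x)) /\
    fine (gibbs (fun x => fact_beta k * potential fact_cost x) (cyl [:: ~~ odd k]))
      <= 2 * eta.
Proof.
move=> eta0 eta1.
pose K : R := 8 / eta.
(* The first bound yields [N_large]. The second yields [MN]: with N = k M and M >= 1, eta N / 2 >= 3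
   M >= M + 2. The last makes k >= 2. *)
exists (Num.bound (K * expR (1 + K)) + Num.bound (6 / eta) + 2)%N => k kk0.
have K0 : 0 < K by rewrite divr_gt0.
have [k' kE] : exists k', k = k'.+2.
  by exists k.-2; case: k kk0 => [|[|k]] //; rewrite !addn2.
have k_gt0 : (0 < k)%N by rewrite kE.
have kK : K * expR (1 + K) <= k%:R.
  apply: le_trans (ltW (archi_boundP _)) _; first by rewrite mulr_ge0 ?expR_ge0// ltW.
  by rewrite ler_nat; apply: leq_trans kk0; rewrite -addnA leq_addr.
have keta : 6 / eta <= k%:R.
  apply: le_trans (ltW (archi_boundP _)) _; first by rewrite divr_ge0// ltW.
  by rewrite ler_nat; apply: leq_trans kk0; rewrite addnAC leq_addl.
apply: (@gibbs_concentration R fact_cost (fact_beta k) fact_cost_gt0 fact_cost_le _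
  (odd k) k`! k.-1`! eta eta0 eta1).
- by apply: le_trans (fact_beta_ge k).
- rewrite ler_pdivrMr// in keta.
  have M1 : 1 <= k.-1`!%:R :> R by rewrite ler1n fact_gt0.
  have -> : k`!%:R = k%:R * k.-1`!%:R :> R by rewrite -natrM kE.
  have : 6 * k.-1`!%:R <= k%:R * eta * k.-1`!%:R by rewrite ler_wpM2r.
  have -> : (k.-1)`!.+2%:R = (k.-1)`!%:R + 2 :> R by rewrite -addn2 natrD.
  lra.
- by apply: le_trans kK _; rewrite ler_nat fact_geq.
- exact: fact_beta_cost_high.
- move=> j kj; apply: fact_beta_cost_low => //.
  rewrite /threshold; case: ex_minnP => i /andP[_ ji] _.
  by rewrite ltnNge; apply: contraL kj => /leq_fact ik; rewrite -leqNgt (leq_trans ji).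
(* For the other letter, a run longer than (k - 1)! has a threshold index of at least k and of
   parity different from that of k, hence beyond k. *)
- move=> j kj; apply: fact_beta_cost_low => //.
  rewrite /threshold; case: ex_minnP => i /andP[/eqP oi ji] _.
  rewrite ltn_neqAle; apply/andP; split.
    by apply/negP => /eqP ki; move: oi; rewrite -ki; case: (odd k).
  rewrite leqNgt; apply: contraL kj => ik; rewrite -leqNgt.
  by apply: leq_trans ji _; apply: leq_fact; rewrite -ltnS prednK.
Qed.

End FactorialCost.

(** * Weak* convergence to a Dirac mass *)

Section WeakStar.
Variable R : realType.

(** [f] is near its value at the fixed point on sequences beginning with [n] letters [b]. Elsewhere
    the Birkhoff sum of the indicator of the other letter is at least 1, and by invariance its
    integral is [n] times the mass of that letter. *)
Lemma Rintegral_near_const (f : Sigma -> R) (b : bool) (e : R) : continuous f ->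
  0 < e -> exists2 d : R, 0 < d & forall nu : probability Sigma R, invariant nu ->
    fine (nu (cyl [:: ~~ b])) <= d -> `|\int[nu]_x f x - f (fun=> b)| <= e.
Proof.
move=> cf e0; have bf := continuous_bounded_measurable cf.
have [_ [B hB]] := bf.
have B0 : 0 <= B by apply: le_trans (hB (fun=> b)).
have e20 : 0 < e / 2 by rewrite divr_gt0.
have [n hn] : exists n, cyl (mkseq (fun=> b) n) `<=` [set y | `|f (fun=> b) - f y| < e / 2].
  by apply/nbhs_cylP; have /cvgrPdist_lt := cf (fun=> b); exact.
have D0 : 0 < n%:R * (2 * B) + 1 by rewrite ltr_wpDl// !mulr_ge0.
exists (e / 2 / (n%:R * (2 * B) + 1)) => [|nu inu hnu]; first by rewrite divr_gt0.
pose I (x : Sigma) : R := \1_(cyl [:: ~~ b]) x.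
have mI : bounded_measurable I by apply: bounded_measurable_indic; exact: measurable_cyl.
have bsum : bounded_measurable (fun x => e / 2 + 2 * B * birkhoff I n x).
  apply: bounded_measurableD; first exact: bounded_measurable_cst.
  by apply: bounded_measurableZ; exact: bounded_measurable_birkhoff.
have pt x : `|f x - f (fun=> b)| <= e / 2 + 2 * B * birkhoff I n x.
  have bk0 : 0 <= birkhoff I n x by apply: sumr_ge0 => i _; rewrite /I indicE.
  have [xn|] := pselect (cyl (mkseq (fun=> b) n) x).
    have /ltW := hn x xn; rewrite /= distrC => h; apply: le_trans h _.
    by rewrite lerDl !mulr_ge0.
  rewrite cyl_mkseq mkseq_eqP => /existsNP[i /not_implyP[il xi]].
  have bk1 : 1 <= birkhoff I n x.
    rewrite /birkhoff (bigD1 (Ordinal il))//= {1}/I indicE mem_set.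
      by rewrite lerDl sumr_ge0// => j _; rewrite /I indicE.
    rewrite cylE; change ([:: iter i shift x 0%N] = [:: ~~ b]).
    by rewrite iter_shiftE addn0; congr [:: _]; move: xi; case: (x i); case: (b).
  have := ler_normB (f x) (f (fun=> b)); have := hB x; have := hB (fun=> b).
  have : 0 <= 2 * B * (birkhoff I n x - 1).
    by apply: mulr_ge0; rewrite ?mulr_ge0// subr_ge0.
  lra.
have key : `|\int[nu]_x f x - f (fun=> b)| <= \int[nu]_x (e / 2 + 2 * B * birkhoff I n x).
  have bd : bounded_measurable (fun x => f x + - f (fun=> b)).
    by apply: bounded_measurableD => //; exact: bounded_measurable_cst.
  have -> : \int[nu]_x f x - f (fun=> b) = \int[nu]_x (f x + - f (fun=> b)).
    rewrite RintegralD ?Rintegral_probability_cst//.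
      exact: bounded_measurable_integrable.
    by apply: bounded_measurable_integrable; exact: bounded_measurable_cst.
  rewrite ler_norml; apply/andP; split; last first.
    by apply: le_Rintegral_bounded => // x; apply: le_trans (ler_norm _) (pt x).
  rewrite -mulN1r -RintegralZl//; last exact: bounded_measurable_integrable.
  apply: le_Rintegral_bounded => //; first exact: bounded_measurableZ.
  by move=> x; rewrite mulN1r lerNl; apply: le_trans (pt x); rewrite -normrN ler_norm.
apply: le_trans key _.
rewrite RintegralD//; last 2 first.
- by apply: bounded_measurable_integrable; exact: bounded_measurable_cst.
- apply: bounded_measurable_integrable; apply: bounded_measurableZ.
  exact: bounded_measurable_birkhoff.
rewrite Rintegral_probability_cst RintegralZl//; last first.
  by apply: bounded_measurable_integrable; exact: bounded_measurable_birkhoff.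
rewrite Rintegral_birkhoff// Rintegral_indic_probability; last exact: measurable_cyl.
rewrite {2}[e]splitr lerD2l.
rewrite ler_pdivlMr// in hnu; apply: le_trans hnu.
set t := fine _; have t0 : 0 <= t by rewrite fine_ge0.
lra.
Qed.

Lemma Rintegral_dirac (f : Sigma -> R) (x : Sigma) : measurable_fun setT f ->
  Rintegral (dirac x : probability Sigma R) setT f = f x.
Proof.
move=> mf; rewrite /Rintegral integral_dirac//; last exact/measurable_EFinP.
by rewrite diracT mul1e.
Qed.

Lemma cvg_delta (u : nat -> probability Sigma R) (b : bool) :
  (forall n, invariant (u n)) ->
  (forall eta, 0 < eta -> eta <= 1 ->
     \forall n \near \oo, fine (u n (cyl [:: ~~ b])) <= 2 * eta) ->
  (u n : wstar R) @[n --> \oo] --> delta R (fun=> b).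
Proof.
move=> iu hu; apply/wstar_cvgP => f.
have cf : continuous f by exact: cts_fun.
have mf : measurable_fun setT (f : Sigma -> R) by exact: measurable_fun_continuous.
rewrite Rintegral_dirac//; apply/cvgrPdist_le => e e0.
have [d d0 hd] := Rintegral_near_const b cf e0.
have m0 : 0 < Num.min 1 (d / 2) by rewrite lt_min ltr01 divr_gt0.
have m1 : Num.min 1 (d / 2) <= 1 by rewrite ge_min lexx.
apply: filterS (hu _ m0 m1) => n hn; rewrite /= distrC; apply: hd => //.
apply: le_trans hn _; have : Num.min 1 (d / 2) <= d / 2 by rewrite ge_min lexx orbT.
lra.
Qed.

End WeakStar.

(** * Maximizing measures *)

Section ConstantSequences.
Variable R : realType.
Implicit Types (mu : probability Sigma R) (f : Sigma -> R).

Lemma adde_fin_idl (x y : \bar R) : x \is a fin_num -> (x + y = x)%E -> y = 0%E.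
Proof. by case: x y => [r| |] [t| |] //= _ [h]; congr EFin; lra. Qed.

Definition nonconstant : set Sigma := [set x | x <> fun=> x 0%N].

Lemma Rintegral_constants mu f (N : set Sigma) : measurable N -> mu N = 0%E ->
  nonconstant `<=` N -> bounded_measurable f ->
  \int[mu]_x f x = f (fun=> true) * fine (mu (cyl [:: true])) +
                   f (fun=> false) * fine (mu (cyl [:: false])).
Proof.
move=> mN N0 sN bf; have [_ [B hB]] := bf.
pose g (x : Sigma) := f (fun=> x 0%N).
have bg : bounded_measurable g.
  exact: (bounded_measurable_label (fun s => f (fun=> s)) measurable_label_head).
transitivity (\int[mu]_x g x); last first.
  rewrite (Rintegral_label mu (fun s => f (fun=> s)) measurable_label_head) big_bool.
  by rewrite /= !preimage_head.
have bN : bounded_measurable (\1_N : Sigma -> R) by exact: bounded_measurable_indic.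
have le x : `|f x - g x| <= 2 * B * \1_N x.
  have [e|ne] := pselect (x = fun=> x 0%N).
    rewrite /g -e subrr normr0 mulr_ge0 ?indicE// mulr_ge0//.
    exact: le_trans (hB x).
  rewrite indicE mem_set ?mulr1; last exact: sN.
  by have := ler_normB (f x) (g x); have := hB x; have := hB (fun=> x 0%N); rewrite -/(g x); lra.
have int0 : \int[mu]_x (2 * B * \1_N x) = 0.
  rewrite RintegralZl//; last exact: bounded_measurable_integrable.
  by rewrite Rintegral_indic_probability// N0 mulr0.
apply/eqP; rewrite eq_le -subr_le0 -[X in _ && X]subr_le0.
rewrite -!RintegralB//; try exact: bounded_measurable_integrable.
rewrite -int0; apply/andP; split; apply: le_Rintegral_bounded.
- exact: bounded_measurableB.
- exact: bounded_measurableZ.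
- by move=> x; apply: le_trans (le x); exact: ler_norm.
- exact: bounded_measurableB.
- exact: bounded_measurableZ.
- by move=> x; apply: le_trans (le x); rewrite distrC ler_norm.
Qed.

Lemma probability_cyl_constants mu (N : set Sigma) w : measurable N -> mu N = 0%E ->
  nonconstant `<=` N ->
  fine (mu (cyl w)) =
  \1_(cyl w) (fun=> true) * fine (mu (cyl [:: true])) +
  \1_(cyl w) (fun=> false) * fine (mu (cyl [:: false])).
Proof.
move=> mN N0 sN; rewrite -Rintegral_indic_probability; last exact: measurable_cyl.
rewrite (Rintegral_constants mN N0 sN)//.
by apply: bounded_measurable_indic; exact: measurable_cyl.
Qed.

Lemma measurable_point (x : Sigma) : measurable [set x].
Proof.
have -> : [set x] = \bigcap_n cyl (mkseq x n).
  apply/seteqP; split=> [y -> n _|y h]; first by rewrite cyl_mkseq.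
  apply/funext => i; have := h i.+1 I; rewrite cyl_mkseq => /mkseq_eqP; exact.
by apply: bigcapT_measurable => n; exact: measurable_cyl.
Qed.

(** The sequences that change letter at once and then never again: the new run is infinite, so the
    potential does not charge them. *)
Definition pre_constant (b : bool) : Sigma := fun n => if n is _.+1 then b else ~~ b.

(** The preimage of the fixed point is the fixed point together with this sequence, and invariance
    gives it the mass of the fixed point alone. *)
Lemma pre_constant_null mu b : invariant mu -> mu [set pre_constant b] = 0%E.
Proof.
move=> imu; have mb := measurable_point (fun=> b).
have E : shift @^-1` [set (fun=> b)] = [set (fun=> b)] `|` [set pre_constant b].
  apply/seteqP; split=> [x /= sx|x [->|->]] //.
  have xE n : x n.+1 = b by exact: (congr1 (fun y : Sigma => y n) sx).
  have [x0|x0] := eqVneq (x 0%N) b; [left|right]; apply/funext => -[|n] //=.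
  by move: x0; case: (x 0%N); case: (b).
have := imu _ mb; rewrite E measureU//.
- exact: adde_fin_idl (fin_num_measure mu _ mb).
- exact: measurable_point.
- apply/seteqP; split=> // x [/= -> /(congr1 (fun y => y 0%N))] /=.
  by case: (b).
Qed.

Lemma preimage_iter_probability mu (A : set Sigma) i : invariant mu -> measurable A ->
  measurable (iter i shift @^-1` A) /\ mu (iter i shift @^-1` A) = mu A.
Proof.
move=> imu mA; elim: i => [|i [mi IH]] //.
have -> : iter i.+1 shift @^-1` A = shift @^-1` (iter i shift @^-1` A).
  by apply/seteqP; split=> x; rewrite /preimage /= -iterSr.
split; last by rewrite imu.
by rewrite -[X in measurable X]setTI; exact: measurable_shift.
Qed.

(** A nonconstant sequence changes letter at some time [i], and its [i]-th shift then lies in [Z];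
    the preimages of [Z] are countably many null sets. *)
Lemma nonconstant_null mu (Z : set Sigma) : invariant mu -> measurable Z -> mu Z = 0%E ->
  (forall x : Sigma, x 0%N != x 1%N -> Z x) ->
  exists N, [/\ measurable N, mu N = 0%E & nonconstant `<=` N].
Proof.
move=> imu mZ Z0 hZ.
pose F i := iter i shift @^-1` Z.
have hF i := preimage_iter_probability i imu mZ.
have : mu.-negligible (\bigcup_i F i).
  apply: negligible_bigcup => i; exists (F i); split=> //; first by case: (hF i).
  by have [_ e] := hF i; exact: etrans e Z0.
move=> [N [mN N0 sN]]; exists N; split=> // x nx; apply: sN.
apply: contrapT => nF; apply: nx; apply/funext => n.
have step i : x i = x i.+1.
  apply: contrapT => ne; apply: nF; exists i => //; apply: hZ.
  by rewrite !iter_shiftE addn0 addn1; apply/eqP.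
by elim: n => // n <-.
Qed.

End ConstantSequences.

Section Maximizing.
Variables (R : realType) (c : bool -> nat -> R).
Hypothesis c_gt0 : forall s n, 0 < c s n.
Hypothesis c_le : forall s n, c s n <= 2 ^- n.
Local Notation phi := (potential c).

Lemma Rintegral_potential_le0 (mu : probability Sigma R) : \int[mu]_x phi x <= 0.
Proof.
rewrite -(Rintegral_probability_cst mu 0); apply: le_Rintegral_bounded.
- exact: bounded_measurable_potential.
- exact: bounded_measurable_cst.
- by move=> x; case/andP: (potential_itv c_gt0 c_le x).
Qed.

Lemma potential_const b : phi (fun=> b) = 0.
Proof. by rewrite /potential eqxx. Qed.

Lemma maximizing_ge0P (mu : probability Sigma R) : invariant mu ->
  maximizing phi mu <-> 0 <= \int[mu]_x phi x.
Proof.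
move=> imu; have bp := bounded_measurable_potential c_gt0 c_le.
have mp : measurable_fun setT phi by case: bp.
split=> [[_ h]|h].
  have := h (dirac one_bar : probability Sigma R).
  rewrite !EFin_Rintegral// lee_fin Rintegral_dirac// (potential_const true).
  exact.
split=> // nu inu; rewrite !EFin_Rintegral// lee_fin.
exact: le_trans (Rintegral_potential_le0 nu) h.
Qed.

Lemma maximizing_null (mu : probability Sigma R) : maximizing phi mu ->
  exists N, [/\ measurable N, mu N = 0%E & nonconstant `<=` N].
Proof.
move=> mmu; have imu : invariant mu by case: mmu.
have bp := bounded_measurable_potential c_gt0 c_le.
have mp : measurable_fun setT phi by case: bp.
have phi0 : \int[mu]_x phi x = 0.
  by apply/eqP; rewrite eq_le Rintegral_potential_le0; exact/(maximizing_ge0P imu).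
have : (\int[mu]_x `|(phi x)%:E|)%E = 0%E.
  have -> : (fun x => `|(phi x)%:E|%E) = (fun x => (-1 * phi x)%:E).
    apply/funext => x; rewrite abse_EFin ler0_norm ?mulN1r//.
    by case/andP: (potential_itv c_gt0 c_le x).
  rewrite (EFin_Rintegral mu (bounded_measurableZ (-1) bp)) RintegralZl ?phi0 ?mulr0//.
  exact: bounded_measurable_integrable.
have mE : measurable_fun [set: Sigma] (fun x => (phi x)%:E) by exact/measurable_EFinP.
move=> /(ae_eq_integral_abs mu measurableT mE)[N [mN N0 sN]].
(* Where the first two letters differ, the potential vanishes only at these two points. *)
pose Z := N `|` ([set pre_constant true] `|` [set pre_constant false]).
apply: (nonconstant_null (Z := Z) imu).
- by apply: measurableU => //; apply: measurableU; exact: measurable_point.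
- have n_point y : mu [set y] = 0%E -> mu.-negligible [set y].
    by move=> y0; exists [set y]; split=> //; exact: measurable_point.
  have [A [mA A0 sA]] : mu.-negligible Z.
    apply: negligibleU; first by exists N; split.
    by apply: negligibleU; apply: n_point; exact: pre_constant_null.
  by apply: (subset_measure0 (B := A)) => //; apply: measurableU => //;
    apply: measurableU; exact: measurable_point.
move=> x x01; have [p0|pn] := eqVneq (phi x) 0; last first.
  by left; apply: sN => /= /(_ I)[] /eqP; rewrite (negbTE pn).
right; move: p0; rewrite /potential (negbTE x01) => /eqP; rewrite oppr_eq0 => /eqP.
move=> /(run_cost_eq0 c_gt0) sx.
have xE n : x n.+1 = x 1%N by exact: (congr1 (fun y : Sigma => y n) sx).
have -> : x = pre_constant (x 1%N).
  apply/funext => -[|n] /=; last exact: xE.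
  by move: x01; case: (x 0%N); case: (x 1%N).
by case: (x 1%N); [left|right].
Qed.

End Maximizing.

(** * Maximality of the entropy at one half *)

Section BinaryEntropy.
Variable R : realType.

(** The right-hand side is the tangent at 1/2 of the strictly concave function - t ln t; its values
    at t and 1 - t add up to ln 2. *)
Lemma entropy_term_lt (t : R) : 0 <= t -> t != 2^-1 ->
  - (t * ln t) < t * ln 2 + 2^-1 - t.
Proof.
rewrite le_eqVlt => /orP[/eqP<- _|t0 t2].
  by rewrite !mul0r oppr0 add0r addr0 invr_gt0.
pose z := - (ln 2 + ln t).
have z0 : z != 0.
  apply: contra t2 => /eqP z0; apply/eqP; apply: ln_inj; rewrite ?posrE ?invr_gt0//.
  by rewrite lnV ?posrE//; move: z0; rewrite /z; lra.
have := expR_gt1Dx z0; rewrite /z expRN expRD !lnK ?posrE// => h.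
have : t * (1 + - (ln 2 + ln t)) < t * (2 * t)^-1 by rewrite ltr_pM2l.
have -> : t * (2 * t)^-1 = 2^-1 by field; rewrite gt_eqF.
lra.
Qed.

Lemma binary_entropy_max (t : R) : 0 <= t <= 1 ->
  ln 2 <= - (t * ln t) - (1 - t) * ln (1 - t) -> t = 2^-1.
Proof.
move=> /andP[t0 t1] h; apply/eqP; apply: contraT => t2.
have h1 := entropy_term_lt t0 t2.
have t1' : 0 <= 1 - t by lra.
have t2' : 1 - t != 2^-1 by apply: contra t2 => /eqP h2; apply/eqP; lra.
have h2 := entropy_term_lt t1' t2'; lra.
Qed.

Lemma binary_entropy_le (t : R) : 0 <= t <= 1 ->
  - (t * ln t) - (1 - t) * ln (1 - t) <= ln 2.
Proof.
move=> /andP[t0 t1]; have [->|t2] := eqVneq t 2^-1.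
  have -> : 1 - 2^-1 = 2^-1 :> R by lra.
  by rewrite lnV ?posrE//; lra.
have h1 := entropy_term_lt t0 t2.
have t1' : 0 <= 1 - t by lra.
have t2' : 1 - t != 2^-1 by apply: contra t2 => /eqP h2; apply/eqP; lra.
have h2 := entropy_term_lt t1' t2'; lra.
Qed.

End BinaryEntropy.

Section MaximalEntropy.
Variables (R : realType) (c : bool -> nat -> R).
Hypothesis c_gt0 : forall s n, 0 < c s n.
Hypothesis c_le : forall s n, c s n <= 2 ^- n.
Local Notation phi := (potential c).
Implicit Types mu : probability Sigma R.

Let mid : probability Sigma R := midpoint_measure R.

Let w1 n : n.-tuple bool := [tuple true | _ < n].
Let w0 n : n.-tuple bool := [tuple false | _ < n].

Lemma proj_const n b : proj n (fun=> b) = [tuple b | _ < n].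
Proof. by []. Qed.

Lemma cyl_tuple_const n (w : n.-tuple bool) b :
  \1_(cyl w) (fun=> b) = (w == [tuple b | _ < n])%:R :> R.
Proof.
rewrite indicE -proj_const -preimage_projE; case: eqP => [->|ne].
  by rewrite mem_set.
by rewrite memNset// => /= e; apply: ne.
Qed.

Lemma marginal_maximizing mu n (w : n.-tuple bool) : maximizing phi mu ->
  fine (pushforward mu (@proj n) [set w]) =
  (w == w1 n)%:R * fine (mu (cyl [:: true])) +
  (w == w0 n)%:R * fine (mu (cyl [:: false])).
Proof.
move=> mmu; have [N [mN N0 sN]] := maximizing_null c_gt0 c_le mmu.
rewrite /pushforward preimage_projE (probability_cyl_constants w mN N0 sN).
by rewrite !cyl_tuple_const.
Qed.

Lemma shannon_measure_maximizing mu n : (0 < n)%N -> maximizing phi mu ->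
  let t := fine (mu (cyl [:: true])) in
  shannon_measure (pushforward mu (@proj n)) = - (t * ln t) - (1 - t) * ln (1 - t).
Proof.
move=> n0 mmu t; rewrite /shannon_measure /shannon.
have w01 : w0 n != w1 n.
  by apply/eqP => /(congr1 (fun w : n.-tuple bool => tnth w (Ordinal n0))); rewrite !tnth_mktuple.
have tE : fine (mu (cyl [:: false])) = 1 - t by have := probability_head mu; rewrite -/t; lra.
rewrite (bigD1 (w1 n))//= (bigD1 (w0 n))//= big1 => [|w /andP[ne1 ne0]]; last first.
  by rewrite marginal_maximizing// (negbTE ne1) (negbTE ne0) !mul0r addr0 mul0r.
rewrite !marginal_maximizing// !eqxx (negbTE w01) eq_sym (negbTE w01).
by rewrite !mul1r !mul0r !addr0 add0r tE opprD.
Qed.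

Lemma fine_midpoint (A : set Sigma) :
  fine (mid A) = 2^-1 * (\1_A one_bar + \1_A zero_bar).
Proof.
transitivity (fine ((2^-1 : R)%:E * measure_add (dirac zero_bar) (dirac one_bar) A)%E).
  by [].
rewrite measure_addE.
transitivity (fine ((2^-1 : R)%:E * ((\1_A zero_bar)%:E + (\1_A one_bar)%:E))%E).
  by [].
by rewrite -EFinD -EFinM /= addrC.
Qed.

Lemma midpoint_maximizing : maximizing phi mid.
Proof.
have bp := bounded_measurable_potential c_gt0 c_le.
have imid : invariant mid.
  move=> A mA; have mS : measurable (shift @^-1` A).
    by rewrite -[X in measurable X]setTI; exact: measurable_shift.
  rewrite -(fineK_probability mid mA) -(fineK_probability mid mS) !fine_midpoint.
  by rewrite !indicE.
apply/(maximizing_ge0P c_gt0 c_le imid).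
pose N := ~` ([set (one_bar : Sigma)] `|` [set (zero_bar : Sigma)]).
have mN : measurable N.
  by apply: measurableC; apply: measurableU; exact: measurable_point.
have N0 : mid N = 0%E.
  rewrite -(fineK_probability mid mN) fine_midpoint !indicE !memNset ?addr0 ?mulr0//.
    by move=> []; right.
  by move=> []; left.
have sN : nonconstant `<=` N.
  move=> x nx; rewrite /N /= => -[] xE; apply: nx; rewrite xE //.
by rewrite (Rintegral_constants mN N0 sN bp) !potential_const !mul0r addr0.
Qed.

Lemma midpoint_head b : fine (mid (cyl [:: b])) = 2^-1.
Proof.
have E s : \1_(cyl [:: b]) (fun=> s) = (s == b)%:R :> R.
  rewrite indicE; case: eqP => [->|ne]; first by rewrite mem_set.
  by rewrite memNset// => -[e]; apply: ne.
by rewrite fine_midpoint (E true) (E false); case: (b) => /=; lra.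
Qed.

(** The marginal of the midpoint has entropy ln 2 and shows that a maximizer exists. The one chosen
    by [mu_star] thus has entropy at least ln 2, which forces the weight 1/2 on the word of ones,
    and [mu] shares this marginal. *)
Lemma max_ent_half n mu : (0 < n)%N -> max_ent phi n mu ->
  fine (mu (cyl [:: true])) = 2^-1.
Proof.
move=> n0 [mmu pmu].
have hmid := midpoint_maximizing.
have sh_mid : shannon_measure (pushforward mid (@proj n)) = ln 2.
  rewrite (shannon_measure_maximizing n0 hmid) midpoint_head.
  have -> : 1 - 2^-1 = 2^-1 :> R by lra.
  by rewrite lnV ?posrE//; lra.
have [|[nu mnu nuE] hstar] := @getPex _ [set m | @marginals R phi n m /\
    forall m', @marginals R phi n m' -> shannon_measure m' <= shannon_measure m].
  exists (pushforward mid (@proj n)); split; first by exists mid.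
  move=> _ [nu mnu <-]; rewrite sh_mid (shannon_measure_maximizing n0 mnu).
  by apply: binary_entropy_le; apply: fine_probability_itv; exact: measurable_cyl.
have := hstar (pushforward mid (@proj n)) (ex_intro2 _ _ mid hmid erefl).
rewrite sh_mid -nuE (shannon_measure_maximizing n0 mnu).
move=> /binary_entropy_max; rewrite fine_probability_itv; last exact: measurable_cyl.
move=> /(_ isT) <-.
have e : pushforward mu (@proj n) = pushforward nu (@proj n) by rewrite pmu; exact: esym nuE.
have w01 : w1 n != w0 n.
  by apply/eqP => /(congr1 (fun w : n.-tuple bool => tnth w (Ordinal n0))); rewrite !tnth_mktuple.
have := congr1 (fun m => fine (m [set w1 n])) e.
by rewrite !marginal_maximizing// eqxx (negbTE w01) !mul1r !mul0r !addr0.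
Qed.

(** For n >= 1 every measure in [max_ent] integrates continuous functions exactly as the midpoint
    does, so the sequences of integrals are eventually constant. *)
Lemma max_ent_lim_midpoint : max_ent_lim phi (midpoint R).
Proof.
move=> u hu; apply/wstar_cvgP => f.
have bf : bounded_measurable (f : Sigma -> R).
  by apply: continuous_bounded_measurable; exact: cts_fun.
have int mu : maximizing phi mu -> fine (mu (cyl [:: true])) = 2^-1 ->
    \int[mu]_x f x = f (fun=> true) * 2^-1 + f (fun=> false) * 2^-1.
  move=> mmu h; have [N [mN N0 sN]] := maximizing_null c_gt0 c_le mmu.
  rewrite (Rintegral_constants mN N0 sN bf) h; congr (_ + _ * _).
  by have := probability_head mu; rewrite h; lra.
have im := int _ midpoint_maximizing (midpoint_head true).
apply: cvg_near_cst; exists 1%N => // n /= n0.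
rewrite [RHS]im; apply: int; first by case: (hu n n0).
exact: max_ent_half n0 (hu n n0).
Qed.

End MaximalEntropy.

(** * Conclusion *)

Section Oscillation.
Variable R : realType.

Definition osc_potential : Sigma -> R := potential (fact_cost R).

(** Restricts the index of [fact_beta] to the parity [b], for which [b] is the letter with long
    runs. *)
Let beta_seq (b : bool) n : R := fact_beta R (n.*2 + b)%N.

Let odd_index (b : bool) n : odd (n.*2 + b) = b.
Proof. by rewrite oddD odd_double addFb oddb. Qed.

Let index_ge (b : bool) n : (n <= n.*2 + b)%N.
Proof. by rewrite -addnn -addnA leq_addr. Qed.

Lemma beta_seq_pinfty b : beta_seq b n @[n --> \oo] --> +oo.
Proof.
apply/cvgryPge => A; exists (Num.bound `|A|) => // n /= le.
apply: le_trans (ler_norm A) _; apply: le_trans (ltW (archi_boundP (normr_ge0 A))) _.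
apply: le_trans (fact_beta_ge R (n.*2 + b)); rewrite ler_nat.
exact: leq_trans le (index_ge b n).
Qed.

Lemma gibbs_seq_cvg b :
  gibbs_family osc_potential (beta_seq b n) @[n --> \oo] --> delta R (fun=> b).
Proof.
apply: cvg_delta => [n|eta eta0 eta1].
  have b0 : 0 <= beta_seq b n by apply: le_trans (fact_beta_ge R _).
  by have [P []] := gibbs_entropy (@fact_cost_gt0 R) (@fact_cost_le R) b0.
have [k0 hk0] := fact_gibbs_concentration eta0 eta1.
exists k0 => // n /= le.
have [_] := hk0 _ (leq_trans le (index_ge b n)).
by rewrite odd_index.
Qed.

Lemma cluster_gibbs b :
  cluster (gibbs_family osc_potential beta @[beta --> +oo]) (delta R (fun=> b)).
Proof.
move=> A B FA nB.
have [N _ hN] := @gibbs_seq_cvg b _ nB.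
have [N' _ hN'] := @beta_seq_pinfty b _ FA.
exists (gibbs_family osc_potential (beta_seq b (maxn N N'))); split.
  by apply: hN'; rewrite /= leq_maxr.
by apply: hN; rewrite /= leq_maxl.
Qed.

(** The continuous test function that separates the two accumulation points. *)
Definition first_symbol (x : Sigma) : R := (x 0%N)%:R.

Lemma continuous_first_symbol : continuous first_symbol.
Proof.
apply: lipschitz_continuous; exists 1; apply: lipschitz_cylP => -[|n] x y.
  move=> _; rewrite expr0 invr1 mulr1 /first_symbol.
  by case: (x 0%N); case: (y 0%N); rewrite ?subrr ?subr0 ?sub0r ?normrN ?normr1 ?normr0.
move=> /mkseq_shift_inj[e _]; rewrite /first_symbol e subrr normr0.
by rewrite mul1r invr_ge0 exprn_ge0.
Qed.

Lemma gibbs_diverges : ~ (exists mu : wstar R,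
  gibbs_family osc_potential beta @[beta --> +oo] --> mu).
Proof.
move=> [mu hmu].
pose f : continuousType Sigma R :=
  HB.pack first_symbol (isContinuous.Build _ _ first_symbol continuous_first_symbol).
have mf : measurable_fun setT first_symbol.
  by apply: measurable_fun_continuous; exact: continuous_first_symbol.
have hf (g : continuousType Sigma R) : Rintegral (gibbs_family osc_potential beta) setT g
    @[beta --> +oo] --> Rintegral mu setT g.
  by move/wstar_cvgP: hmu; exact.
have lim (b : bool) : Rintegral mu setT f = b%:R.
  have h1 : Rintegral (gibbs_family osc_potential (beta_seq b n)) setT f
      @[n --> \oo] --> Rintegral mu setT f.
    exact: cvg_comp (@beta_seq_pinfty b) (hf f).
  have h2 : Rintegral (gibbs_family osc_potential (beta_seq b n)) setT f
      @[n --> \oo] --> Rintegral (delta R (fun=> b)) setT f.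
    by have /wstar_cvgP := @gibbs_seq_cvg b; exact.
  rewrite Rintegral_dirac// in h2.
  by rewrite -(cvg_lim _ h1)// (cvg_lim _ h2).
by have := lim true; rewrite (lim false) => /eqP; rewrite eq_sym oner_eq0.
Qed.

End Oscillation.

Theorem mainTheorem9 (R : realType) :
  (exists phi : Sigma -> R,
    [/\ lipschitz_potential phi,
        cluster (gibbs_family phi beta @[beta --> +oo]) (delta R zero_bar),
        cluster (gibbs_family phi beta @[beta --> +oo]) (delta R one_bar),
        ~ (exists mu : wstar R, gibbs_family phi beta @[beta --> +oo] --> mu) &
        max_ent_lim phi (midpoint R)]) /\
  ~ (forall phi : Sigma -> R, lipschitz_potential phi ->
      (exists mu : wstar R, gibbs_family phi beta @[beta --> +oo] --> mu) <->
      (exists mu : wstar R, max_ent_lim phi mu)).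
Proof.
have lip := potential_lipschitz (@fact_cost_gt0 R) (@fact_cost_le R).
have mlim := max_ent_lim_midpoint (@fact_cost_gt0 R) (@fact_cost_le R).
split.
  exists (osc_potential R); split=> //.
  - exact: (cluster_gibbs (b := false)).
  - exact: (cluster_gibbs (b := true)).
  - exact: gibbs_diverges.
move=> h; apply: (@gibbs_diverges R); apply/(h _ lip).
by exists (midpoint R).
Qed.
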